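(* Let $X=X(K,U)$ be an Oeljeklaus–Toma (OT) manifold of type $(s,t)$. There exists at most one Lee class of an LCK metric on $X$, namely the one represented by the $U\ltimes O_K$-invariant form on $\mathbb{H}^s\times\mathbb{C}^t$ $$\theta=\frac1t\, d\ln\Big(\prod_{k=1}^s v_k\Big).$$ That is, the de Rham class in $H^1(X,\mathbb{R})$ of the Lee form of any LCK metric on $X$ equals $[\theta]$.
   Context: OT manifolds: let $s,t>0$, $m=s+t$, $n=s+2t$, and let $K$ be a number field with exactly $s$ real embeddings $\sigma_1,\ldots,\sigma_s$ and $2t$ non-real embeddings $\sigma_{s+1},\ldots,\sigma_{n}$ in $\mathbb{C}$, ordered so that $\sigma_{s+t+i}=\overline{\sigma_{s+i}}$ for $1\le i\le t$. Let $O_K$ be the ring of integers, and $O_K^{*,+}=\{u\in O_K^*\mid \sigma_i(u)>0,\ 1\le i\le s\}$. Let $\mathbb{H}$ be the upper half plane, with holomorphic coordinates $(w_1,\ldots,w_s,z_1,\ldots,z_t)$ on $\mathbb{H}^s\times\mathbb{C}^t$. $O_K$ acts on $\mathbb{H}^s\times\mathbb{C}^t$ by translations $T_a(w,z)=(w_1+\sigma_1(a),\ldots,w_s+\sigma_s(a),z_1+\sigma_{s+1}(a),\ldots,z_t+\sigma_{s+t}(a))$ and $O_K^{*,+}$ acts by $R_u(w,z)=(\sigma_1(u)w_1,\ldots,\sigma_s(u)w_s,\sigma_{s+1}(u)z_1,\ldots,\sigma_{s+t}(u)z_t)$. Let $U\subset O_K^{*,+}$ be a subgroup of rank $s$ such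 that $u\mapsto(\sigma_1(u),\ldots,\sigma_s(u))$ embeds $U$ as a lattice in the multiplicative group $(\mathbb{R}_{>0})^s$. Then $\Gamma=U\ltimes O_K$ acts freely and properly discontinuously on $\mathbb{H}^s\times\mathbb{C}^t$ and the OT manifold of type $(s,t)$ associated to $(K,U)$ is the compact complex manifold $X(K,U)=(\mathbb{H}^s\times\mathbb{C}^t)/\Gamma$. $v_k=\operatorname{Im}w_k$. $\Gamma$-invariant forms on $\mathbb{H}^s\times\mathbb{C}^t$ are regarded as forms on $X$. LCK metric: a Hermitian metric on a complex manifold whose fundamental form $\Omega$ satisfies $d\Omega=\eta\wedge\Omega$ for a closed real one-form $\eta$, called the Lee form; its Lee class is the de Rham class $[\eta]\in H^1(X,\mathbb{R})$. *)

(* Defs.v *)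
From HB Require Import structures.
From mathcomp Require Import all_boot all_order all_algebra all_field.
From mathcomp Require Import all_classical all_reals all_analysis.
From mathcomp Require Import complex.

Set Implicit Arguments.
Unset Strict Implicit.
Unset Printing Implicit Defensive.

Import Order.TTheory GRing.Theory Num.Theory.
Import numFieldNormedType.Exports.

Local Open Scope classical_set_scope.
Local Open Scope ring_scope.
Local Open Scope complex_scope.

(* C^m as a real normed space: (x, y) stands for x + iy, so that p.1 0 k and
   p.2 0 k are the real and imaginary parts of the k-th complex coordinate. *)
Notation cspace R m := ('rV[R]_m * 'rV[R]_m)%type.

Section ComplexCoordinates.
Variables (R : realType) (m : nat).

Definition ccoord (p : cspace R m) (k : 'I_m) : R[i] := p.1 0 k +i* p.2 0 k.

Definition cpoint (z : 'I_m -> R[i]) : cspace R m :=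
  (\row_k complex.Re (z k), \row_k complex.Im (z k)).

Definition Jmul (v : cspace R m) : cspace R m := (- v.2, v.1).

End ComplexCoordinates.

(* Differential forms of low degree on an open subset D of C^m. A form is a
   total function of the base point and of constant tangent vectors; only its
   values at base points in D are meaningful. *)
Section Forms.
Variables (R : realType) (m : nat).
Local Notation V := (cspace R m).

Fixpoint is_Ck (n : nat) (D : set V) (f : V -> R) : Prop :=
  (forall p, D p -> {for p, continuous f}) /\
  match n with
  | 0 => True
  | n'.+1 => forall v, (forall p, D p -> derivable f p v) /\
                       is_Ck n' D (fun p => 'D_v f p)
  end.

Definition smooth_on (D : set V) (f : V -> R) : Prop := forall n, is_Ck n D f.

Definition form1 := V -> V -> R.
Definition form2 := V -> V -> V -> R.
Definition form3 := V -> V -> V -> V -> R.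

Definition smooth_form1 (D : set V) (a : form1) : Prop :=
  (forall p, D p -> scalar (a p)) /\
  (forall v, smooth_on D (fun p => a p v)).

Definition ext_d0 (f : V -> R) : form1 := fun p v => 'D_v f p.

(* The usual invariant formulas for d, evaluated on constant vector fields
   (whose Lie brackets vanish). *)
Definition ext_d1 (a : form1) : form2 := fun p u v =>
  'D_u (fun q => a q v) p - 'D_v (fun q => a q u) p.

Definition ext_d2 (w : form2) : form3 := fun p x y z =>
  'D_x (fun q => w q y z) p - 'D_y (fun q => w q x z) p
  + 'D_z (fun q => w q x y) p.

Definition wedge12 (a : form1) (w : form2) : form3 := fun p x y z =>
  a p x * w p y z - a p y * w p x z + a p z * w p x y.

Definition pullback1 (g : V -> V) (a : form1) : form1 :=
  fun p v => a (g p) ('d g p v).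

Definition pullback2 (g : V -> V) (w : form2) : form2 :=
  fun p u v => w (g p) ('d g p u) ('d g p v).

Definition hermitian_metric (D : set V) (h : form2) : Prop :=
  [/\ forall u v, smooth_on D (fun p => h p u v),
      forall p, D p -> forall u, scalar (h p u),
      forall p, D p -> forall u v, h p u v = h p v u,
      forall p, D p -> forall u v, h p (Jmul u) (Jmul v) = h p u v &
      forall p, D p -> forall v, v != 0 -> 0 < h p v v].

Definition fundamental_form (h : form2) : form2 := fun p u v => h p (Jmul u) v.

End Forms.

Section NumberField.
Variables (R : realType) (s t : nat) (K : fieldExtType rat).

Definition ring_of_integers : set K := [set a | integralOver (intr : int -> K) a].

Definition unit_of_integers : set K :=
  [set u | [/\ u != 0, ring_of_integers u & ring_of_integers u^-1]].

Variable sigma : 'I_(s + t + t) -> {rmorphism K -> R[i]}.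

Definition emb_real (i : 'I_s) : K -> R[i] := sigma (lshift t (lshift t i)).

(* sigma lists every embedding of K exactly once: s real ones, then t
   non-real ones, then the conjugates of the latter in the same order. *)
Definition embeddings_of_type : Prop :=
  [/\ forall i j, sigma i =1 sigma j -> i = j,
      forall f : {rmorphism K -> R[i]}, exists i, f =1 sigma i,
      forall (i : 'I_s) a, complex.Im (emb_real i a) = 0,
      forall k : 'I_(s + t + t),
        (s <= k)%N -> exists a, complex.Im (sigma k a) != 0 &
      forall (j : 'I_t) a,
        sigma (rshift (s + t) j) a = (sigma (lshift t (rshift s j)) a)^*].

(* In R[i], 0 < z means that z is real and positive. *)
Definition positive_units : set K :=
  [set u | unit_of_integers u /\ forall i : 'I_s, 0 < emb_real i u].

Definition mul_subgroup (U : set K) : Prop :=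
  [/\ U 1, forall u v, U u -> U v -> U (u * v) & forall u, U u -> U u^-1].

Definition mul_independent (r : nat) (e : 'I_r -> K) : Prop :=
  forall k : 'I_r -> int, \prod_i e i ^ k i = 1 -> forall i, k i = 0.

Definition mul_rank (U : set K) (r : nat) : Prop :=
  (exists2 e : 'I_r -> K, (forall i, U (e i)) & mul_independent e) /\
  ~ (exists2 e : 'I_r.+1 -> K, (forall i, U (e i)) & mul_independent e).

Definition real_embedding (u : K) : 'rV[R]_s :=
  \row_i complex.Re (emb_real i u).

(* L is a discrete cocompact subset of the multiplicative group (R_{>0})^s;
   it is used below for images of subgroups. *)
Definition mul_lattice (L : set 'rV[R]_s) : Prop :=
  [/\ forall x, L x -> forall i, 0 < x 0 i,
      exists2 N, nbhs (const_mx 1 : 'rV[R]_s) N &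
        forall x, L x -> N x -> x = const_mx 1 &
      exists C : set 'rV[R]_s,
        [/\ compact C, forall c, C c -> forall i, 0 < c 0 i &
          forall x : 'rV[R]_s, (forall i, 0 < x 0 i) ->
            exists c l, [/\ C c, L l & forall i, x 0 i = c 0 i * l 0 i]]].

Definition OT_subgroup (U : set K) : Prop :=
  [/\ mul_subgroup U, U `<=` positive_units, mul_rank U s,
      {in U &, injective real_embedding} &
      mul_lattice (real_embedding @` U)].

End NumberField.

(* Forms on the OT manifold X(K,U) = (H^s x C^t) / (U |x O_K) are the
   U |x O_K-invariant forms on H^s x C^t. *)
Section OTManifold.
Variables (R : realType) (s t : nat) (K : fieldExtType rat).
Variables (sigma : 'I_(s + t + t) -> {rmorphism K -> R[i]}) (U : set K).
Local Notation V := (cspace R (s + t)).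

Definition upper_domain : set V :=
  [set p : V | forall k : 'I_s, 0 < p.2 0 (lshift t k)].

Definition transl (a : K) (p : V) : V :=
  cpoint (fun k => ccoord p k + sigma (lshift t k) a).

Definition dilate (u : K) (p : V) : V :=
  cpoint (fun k => sigma (lshift t k) u * ccoord p k).

Definition Gamma : set (V -> V) :=
  [set g | exists u a,
     [/\ U u, ring_of_integers a & g = transl a \o dilate u]].

Definition X_function (f : V -> R) : Prop :=
  smooth_on upper_domain f /\
  forall g, Gamma g -> forall p, upper_domain p -> f (g p) = f p.

Definition X_form1 (a : form1 R (s + t)) : Prop :=
  smooth_form1 upper_domain a /\
  forall g, Gamma g -> forall p, upper_domain p ->
    forall v, pullback1 g a p v = a p v.

Definition X_closed1 (a : form1 R (s + t)) : Prop :=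
  X_form1 a /\ forall p, upper_domain p -> forall u v, ext_d1 a p u v = 0.

Definition X_hermitian_metric (h : form2 R (s + t)) : Prop :=
  hermitian_metric upper_domain h /\
  forall g, Gamma g -> forall p, upper_domain p ->
    forall u v, pullback2 g h p u v = h p u v.

(* The class of a in H^1(X, R), as the set of its representatives. *)
Definition deRham_class (a : form1 R (s + t)) : set (form1 R (s + t)) :=
  [set b | X_closed1 b /\
     exists2 f, X_function f &
       forall p, upper_domain p -> forall v, b p v - a p v = ext_d0 f p v].

Definition is_LCK (h : form2 R (s + t)) (eta : form1 R (s + t)) : Prop :=
  [/\ X_hermitian_metric h, X_closed1 eta &
      forall p, upper_domain p -> forall x y z,
        ext_d2 (fundamental_form h) p x y z =
        wedge12 eta (fundamental_form h) p x y z].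

Definition Lee_classes : set (set (form1 R (s + t))) :=
  [set c | exists h eta, is_LCK h eta /\ c = deRham_class eta].

End OTManifold.

Definition OT_theta (R : realType) (s t : nat) : form1 R (s + t) :=
  fun p v => t%:R^-1 *
    ext_d0 (fun q : cspace R (s + t) =>
              ln (\prod_(k < s) q.2 0 (lshift t k))) p v.

Arguments OT_theta R s t : clear implicits.

(* Main.v *)
Require Import Defs.
From HB Require Import structures.
From mathcomp Require Import all_boot all_order all_algebra all_field.
From mathcomp Require Import all_classical all_reals all_analysis.
From mathcomp Require Import complex.
From mathcomp Require Import ring.

(* Write the Lee form as eta = dF on the convex domain H^s x C^t; then F o g - F is
   a constant, the period of g in Gamma. Periods vanish on translations because
   O_K / (u - 1) O_K is torsion for u <> 1 in U. Hence e^-F Omega is a closed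
   O_K-periodic form, multiplied by e^-period(u) under u. Averaged over the torus
   (R^s x C^t) / O_K, its coefficient on the real plane of z_j is a positive
   constant, since closedness expresses its derivatives through derivatives along
   the torus. Under u that coefficient is scaled pointwise by
   e^-period(u) / |sigma_(s+j) u|^2; positivity, compactness of the torus and
   constancy of the average force this factor to be 1. Taking the product over j,
   with the norm of u equal to 1, gives t period(u) = ln (prod_k sigma_k u), which
   is the period of theta, so F - (1/t) ln (prod_k v_k) descends to X. *)

Set Implicit Arguments.
Unset Strict Implicit.
Unset Printing Implicit Defensive.

Import Order.TTheory GRing.Theory Num.Theory.
Import numFieldNormedType.Exports.

Local Open Scope classical_set_scope.
Local Open Scope ring_scope.
Local Open Scope complex_scope.

(** * Integrals over the unit interval depending on a parameter *)

(** The planes of the [z_j] are singled out because both of their real directions lie in the torus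
    R^s x C^t, whereas the plane of [w_k] meets it only in its real axis; closedness makes an
    averaged coefficient constant only when both of its arguments are torus directions. The average
    is an iterated integral over unit segments along finitely many lattice vectors, and what is
    transported by [u] is not the average but a pointwise lower bound. If the scaling factor [q]
    exceeded 1, the coefficient would be at least [q ^+ k * c] on the whole torus leaf through the
    k-th image of the base point, while its average there equals the one at the base point, a fixed
    number. Hence [q <= 1], and the inverse unit gives the opposite inequality. This choice lets the
    lattice vectors come from the powers of a single algebraic integer: [u] only has to preserve
    their real span, which is all of R^s x C^t. *)

Local Notation itv01 R := [set` `[0%R : R, 1%R : R]].

Section UnitIntervalIntegral.
Variable R : realType.
Local Notation mu := (@lebesgue_measure R).

Definition int01 (f : R -> R) : R := (\int[mu]_(x in itv01 R) f x)%R.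

Lemma in01P (x : R) : itv01 R x <-> 0 <= x <= 1.
Proof. by rewrite /= in_itv. Qed.

Lemma continuous_within01 (f : R -> R) :
  (forall x, itv01 R x -> {for x, continuous f}) -> {within itv01 R, continuous f}.
Proof. by move=> cf; apply: continuous_in_subspaceT => x /set_mem /cf. Qed.

Lemma integrable01 (f : R -> R) : (forall x, itv01 R x -> {for x, continuous f}) ->
  mu.-integrable (itv01 R) (EFin \o f).
Proof.
move=> cf; apply: continuous_compact_integrable; first exact: segment_compact.
exact: continuous_within01.
Qed.

Lemma eq_int01 (f g : R -> R) : (forall x, itv01 R x -> f x = g x) ->
  int01 f = int01 g.
Proof. by move=> fg; apply: eq_Rintegral => x /set_mem /fg. Qed.

Lemma int01_cst (c : R) : int01 (fun=> c) = c.
Proof.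
rewrite /int01 Rintegral_cst//= lebesgue_measure_itv/= lte_fin ltr01.
by rewrite sube0 mulr1.
Qed.

Lemma int01B (f g : R -> R) : (forall x, itv01 R x -> {for x, continuous f}) ->
  (forall x, itv01 R x -> {for x, continuous g}) ->
  int01 (fun x => f x - g x) = int01 f - int01 g.
Proof. by move=> cf cg; apply: RintegralB => //; exact: integrable01. Qed.

Lemma int01Z (c : R) (f : R -> R) : (forall x, itv01 R x -> {for x, continuous f}) ->
  int01 (fun x => c * f x) = c * int01 f.
Proof. by move=> cf; apply: RintegralZl => //; exact: integrable01. Qed.

Lemma le_int01 (f g : R -> R) : (forall x, itv01 R x -> {for x, continuous f}) ->
  (forall x, itv01 R x -> {for x, continuous g}) ->
  (forall x, itv01 R x -> f x <= g x) -> int01 f <= int01 g.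
Proof.
by move=> cf cg fg; rewrite /int01; apply: le_Rintegral => //;
  exact: integrable01.
Qed.

Lemma int01_norm_le (f : R -> R) (e : R) :
  (forall x, itv01 R x -> {for x, continuous f}) ->
  (forall x, itv01 R x -> `|f x| <= e) -> `|int01 f| <= e.
Proof.
move=> cf fe; rewrite ler_norml -{1}[e]int01_cst -{2}[e]int01_cst.
have ce (c : R) x : itv01 R x -> {for x, continuous (fun=> c : R)}.
  by move=> _; exact: cvg_cst.
rewrite -mulN1r -int01Z; last exact: ce.
have f_bd x : itv01 R x -> - e <= f x <= e by move=> /fe; rewrite ler_norml.
apply/andP; split; apply: le_int01 => //.
- by move=> x _; apply: cvg_cst.
- by move=> x /f_bd /andP[]; rewrite mulN1r.
- exact: ce.
- by move=> x /f_bd /andP[].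
Qed.

Lemma int01_derive (F f : R -> R) :
  (forall x, itv01 R x -> is_derive x 1 F (f x)) ->
  (forall x, itv01 R x -> {for x, continuous f}) -> int01 f = F 1 - F 0.
Proof.
move=> dF cf.
have cF x : itv01 R x -> {for x, continuous F}.
  move=> /dF [/derivable1_diffP dFx _]; exact: differentiable_continuous.
have I0 : itv01 R 0 by apply/in01P; rewrite lexx ler01.
have I1 : itv01 R 1 by apply/in01P; rewrite lexx ler01.
rewrite /int01 /Rintegral (@continuous_FTC2 _ f F) ?ltr01//.
- exact: continuous_within01.
- split.
  + by move=> x /subset_itv_oo_cc /dF [].
  + by apply: cvg_at_right_filter; apply: cF.
  + by apply: cvg_at_left_filter; apply: cF.
- move=> x /subset_itv_oo_cc /dF dFx; rewrite derive1E; exact: derive_val.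
Qed.

Lemma pair_continuousr (T U : topologicalType) (p : T) (x : U) :
  {for x, continuous (pair p)}.
Proof.
apply: (@cvg_pair _ _ _ (nbhs x) (nbhs p) (nbhs x)); last exact: cvg_id.
exact: cvg_cst.
Qed.

(** Tube lemma: compactness of the unit interval merges the neighbourhoods of the points [(p, x)]
    into one neighbourhood of [p]. It supplies the uniformity in all later limits under the integral
    sign. *)
Lemma near01 (T : topologicalType) (P : T -> R -> Prop) (p : T) :
  (forall x, itv01 R x -> \forall z \near (p, x), P z.1 z.2) ->
  \forall q \near p, forall x, itv01 R x -> P q x.
Proof.
move=> H.
have /compact_near_coveringP := @segment_compact R 0 1.
move=> /(_ _ (nbhs p) P _) K; apply: filterS (K _) => x Ix //.
have [[A B] /= [Ap Bx] AB] := H _ Ix.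
by exists (B, A) => //= -[x' q] [/= ? ?]; exact: (AB (q, x')).
Qed.

Lemma near01_dist_lt (T : topologicalType) (g : T -> R -> R) (p : T) (e : R) :
  (forall x, itv01 R x -> {for (p, x), continuous (fun z => g z.1 z.2)}) -> 0 < e ->
  \forall q \near p, forall x, itv01 R x -> `|g p x - g q x| < e.
Proof.
move=> cg e0; apply: near01 => x Ix.
have e20 : 0 < e / 2 by rewrite divr_gt0.
have cgx : g p @ x --> g p x.
  by move=> A nA; exact: (pair_continuousr (cg x Ix A nA)).
have /cvgrPdist_lt /(_ _ e20) C1 := cg x Ix.
have C2 : \forall z \near (p, x), `|g p x - g p z.2| < e / 2.
  by move/cvgrPdist_lt : cgx => /(_ _ e20) /(@cvg_snd _ _ (nbhs p) (nbhs x)).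
near=> z.
have -> : g p z.2 - g z.1 z.2
  = (g p x - g z.1 z.2) - (g p x - g p z.2) by ring.
rewrite [e]splitr (le_lt_trans (ler_normB _ _))// ltrD//.
- by near: z.
- by near: z.
Unshelve. all: by end_near. Qed.

Lemma int01_continuous (T : topologicalType) (g : T -> R -> R) (p : T) :
  (forall x, itv01 R x -> {for (p, x), continuous (fun z => g z.1 z.2)}) ->
  (\forall q \near p, forall x, itv01 R x -> {for x, continuous (g q)}) ->
  {for p, continuous (fun q => int01 (g q))}.
Proof.
move=> cg cgx; apply/cvgrPdist_lt => e e0.
have e20 : 0 < e / 2 by rewrite divr_gt0.
have U := near01_dist_lt cg e20.
near=> q.
have cp : forall x, itv01 R x -> {for x, continuous (g p)} by apply: nbhs_singleton cgx.
have cq : forall x, itv01 R x -> {for x, continuous (g q)} by near: q.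
rewrite -int01B//; apply: (@le_lt_trans _ _ (e / 2)); last by rewrite [ltRHS]splitr ltrDl.
apply: int01_norm_le.
  by move=> x Ix; apply: cvgB; [exact: cp | exact: cq].
by move=> x Ix; apply: ltW; move: x Ix; near: q.
Unshelve. all: by end_near. Qed.

End UnitIntervalIntegral.

(** * Directional derivatives and differentiation under the integral sign *)

Section DerivativeAlongLines.
Variables (R : realType) (V : normedModType R).

(** The two difference quotients agree up to the order of a sum. This transfers the one-variable
    chain rule and mean value theorem to directional derivatives. *)
Lemma is_derive_lineP (W : normedModType R) (f : V -> W) (p v : V) (h : R) (d : W) :
  is_derive h 1 (fun t => f (p + t *: v)) d <-> is_derive (p + h *: v) v f d.
Proof.
have E : (fun k : R => k^-1 *: (((fun t => f (p + t *: v)) \o shift h) (k *: 1)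
      - f (p + h *: v))) =
   (fun k : R => k^-1 *: ((f \o shift (p + h *: v)) (k *: v) - f (p + h *: v))).
  apply/funext => k /=; congr (_ *: (f _ - _)).
  by rewrite scalerDl -scalerA scale1r addrC addrAC addrA addrAC.
split=> -[df <-]; split.
- by rewrite /derivable -E.
- by rewrite /derive -E.
- by rewrite /derivable E.
- by rewrite /derive E.
Qed.

Lemma is_derive_scaledir (f : V -> R) (p v : V) (c d : R) :
  is_derive p v f d -> is_derive p (c *: v) f (c * d).
Proof.
move=> df; rewrite -[p]addr0 -(scale0r (c *: v)); apply/(@is_derive_lineP _ f).
have -> : (fun t => f (p + t *: (c *: v))) =
    (fun t => f (p + t *: v)) \o (fun t => t * c).
  by apply/funext => t /=; rewrite scalerA.
have dm : is_derive (0 : R) 1 (fun t : R => t * c) c.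
  by apply: is_derive_eq; rewrite /GRing.scale/= mulr0 add0r mulr1.
have d0 : is_derive (0 * c) 1 (fun t => f (p + t *: v)) d.
  by apply/(@is_derive_lineP _ f); rewrite mul0r scale0r addr0.
by have := @is_derive1_comp _ (fun t => f (p + t *: v)) (fun t => t * c) _ _ _ d0 dm;
  rewrite mulrC.
Qed.

(** The intermediate point given by the mean value theorem may lie anywhere on the segment from [p]
    to [p + h *: v], so a property near [p] is wanted along all of it. *)
Lemma near01_line (p v : V) (P : V -> Prop) : (\forall q \near p, P q) ->
  \forall h \near (0 : R), forall c, (itv01 R) c ->
    P (p + (c * h) *: v).
Proof.
move=> pP; apply: near01 => x _.
have : (fun z : R * R => p + (z.2 * z.1) *: v) @ (0, x) --> p + (x * 0) *: v.
  apply: cvgD; first exact: cvg_cst.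
  apply: cvgZr_tmp; apply: cvgM.
  - exact: (@cvg_snd _ _ (nbhs 0) (nbhs x)).
  - exact: (@cvg_fst _ _ (nbhs 0) (nbhs x)).
by rewrite mulr0 scale0r addr0 => /(_ _ pP).
Qed.

(** Leibniz rule. For each [x] the mean value theorem rewrites the difference quotient as [dg] at a
    point between [p] and [p + h *: v], and joint continuity of [dg] with compactness of the
    interval makes this close to [dg p x] uniformly in [x]. *)
Lemma is_derive_int01 (D : set V) (g dg : V -> R -> R) (p v : V) :
  open D -> D p ->
  (forall q x, D q -> (itv01 R) x -> {for x, continuous (g q)}) ->
  (forall q x, D q -> (itv01 R) x -> is_derive q v (g^~ x) (dg q x)) ->
  (forall q x, D q -> (itv01 R) x ->
    {for (q, x), continuous (fun z => dg z.1 z.2)}) ->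
  is_derive p v (fun q => int01 (g q)) (int01 (dg p)).
Proof.
move=> oD Dp cg dgP cdg.
suff H : (fun h : R => h^-1 *: (((fun q => int01 (g q)) \o shift p) (h *: v)
    - int01 (g p))) @ 0^' --> int01 (dg p).
  by apply: DeriveDef; [apply/cvg_ex; exists (int01 (dg p)) | exact/cvg_lim].
apply/cvgrPdist_lt => e e0.
have e20 : 0 < e / 2 by rewrite divr_gt0.
have cdgx q x : D q -> (itv01 R) x -> {for x, continuous (dg q)}.
  move=> Dq Ix; by move=> A nA; exact: (pair_continuousr (cdg q x Dq Ix A nA)).
have U : \forall q \near p, D q /\ forall x, (itv01 R) x ->
    `|dg p x - dg q x| < e / 2.
  near=> q; split; first by near: q; exact: open_nbhs_nbhs.
  by near: q; apply: near01_dist_lt => // x Ix; exact: cdg.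
have {}U := near01_line v U.
near=> h.
have h0 : h != 0 by near: h; exact: nbhs_dnbhs_neq.
have Uh : forall c, (itv01 R) c -> D (p + (c * h) *: v) /\
    forall x, (itv01 R) x -> `|dg p x - dg (p + (c * h) *: v) x| < e / 2.
  by near: h; apply: nbhs_dnbhs.
have Dph : D (p + h *: v).
  by have [] := Uh 1 (iffRL (in01P _) _); rewrite ?mul1r ?lexx ?ler01.
rewrite /= -int01B; last 2 first.
- by rewrite addrC => x; exact: cg.
- by move=> x; exact: cg.
rewrite /GRing.scale/= -int01Z; last first.
  by move=> x Ix; apply: cvgB; [rewrite addrC; exact: cg|exact: cg].
rewrite -int01B; last 2 first.
- by move=> x; exact: cdgx.
- move=> x Ix; apply: cvgMr; apply: cvgB; [rewrite addrC; exact: cg|exact: cg].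
apply: (@le_lt_trans _ _ (e / 2)); last by rewrite [ltRHS]splitr ltrDl.
apply: int01_norm_le.
  move=> x Ix; apply: cvgB; first exact: cdgx.
  by apply: cvgMr; apply: cvgB; [rewrite addrC; exact: cg|exact: cg].
move=> x Ix.
pose phi t := g (p + t *: (h *: v)) x.
have dphi c : (itv01 R) c ->
    is_derive c 1 phi (h * dg (p + (c * h) *: v) x).
  move=> Ic; apply/(@is_derive_lineP _ (g^~ x)); apply: is_derive_scaledir.
  by rewrite scalerA; apply: dgP => //; have [] := Uh _ Ic.
have cphi : {within (itv01 R), continuous phi}.
  apply: continuous_within01 => c /dphi [/derivable1_diffP dphic _].
  exact: differentiable_continuous.
have [c Ic] := MVT_segment ler01 (fun c Ic => dphi c (subset_itv_oo_cc Ic)) cphi.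
rewrite /phi scale1r scale0r addr0 subr0 mulr1 [h *: v + p]addrC => ->.
by rewrite mulrA mulVf// mul1r; apply: ltW; have [_] := Uh _ Ic; exact.
Unshelve. all: by end_near. Qed.

End DerivativeAlongLines.

(** * Functions of class C^k *)

Lemma is_derive_line0P (R : realType) (V W : normedModType R) (f : V -> W)
    (p v : V) (d : W) :
  is_derive p v f d <-> is_derive (0 : R) 1 (fun t => f (p + t *: v)) d.
Proof.
split=> [df|/(@is_derive_lineP _ _ _ f)]; last by rewrite scale0r addr0.
by apply/(@is_derive_lineP _ _ _ f); rewrite scale0r addr0.
Qed.

Lemma is_derive_comp1 (R : realType) (V : normedModType R) (f : V -> R)
    (g : R -> R) (p v : V) (d e : R) :
  is_derive p v f d -> is_derive (f p) 1 g e ->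
  is_derive p v (fun q => g (f q)) (e * d).
Proof.
move=> /is_derive_line0P df dg; apply/is_derive_line0P.
apply: (@is_derive1_comp _ g (fun t => f (p + t *: v))) => //.
by rewrite scale0r addr0.
Qed.

Lemma constant_on_segment (R : realType) (V : normedModType R) (f : V -> R)
    (p v : V) :
  (forall x : R, 0 <= x <= 1 -> is_derive (p + x *: v) v f 0) ->
  f (p + v) = f p.
Proof.
move=> df.
have dphi (c : R) : 0 <= c <= 1 -> is_derive c 1 (fun t => f (p + t *: v)) 0.
  by move=> /df ?; apply/(@is_derive_lineP _ _ _ f).
have cphi : {within (itv01 R), continuous (fun t => f (p + t *: v))}.
  apply: continuous_within01 => c /in01P /dphi [/derivable1_diffP + _].
  exact: differentiable_continuous.
have [] := @MVT_segment _ (fun t => f (p + t *: v)) (fun=> 0) _ _ ler01 _ cphi.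
  by move=> c /subset_itv_oo_cc; rewrite in_itv/=; exact: dphi.
by move=> c _ /eqP; rewrite mul0r scale1r scale0r addr0 subr_eq0 => /eqP.
Qed.

Section ClassCk.
Variables (R : realType) (m : nat).
Local Notation V := (cspace R m).
Implicit Types (D : set V) (f g : V -> R).

(** Forms are total functions about which something is known only on the open set [D]. Limits and
    derivatives at points of [D] therefore have to be transported between functions that agree on
    [D] alone. *)
Lemma near_eq_on D f g (p : V) : open D -> D p -> (forall q, D q -> f q = g q) ->
  \forall q \near p, f q = g q.
Proof. by move=> oD Dp fg; apply: filterS (open_nbhs_nbhs (conj oD Dp)). Qed.

Lemma eq_on_is_derive D f g (p v : V) (d : R) : open D -> D p ->
  (forall q, D q -> f q = g q) -> is_derive p v f d -> is_derive p v g d.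
Proof. by move=> oD Dp fg; apply: near_eq_is_derive; exact: near_eq_on Dp fg. Qed.

Lemma eq_on_derive D f g (p v : V) : open D -> D p ->
  (forall q, D q -> f q = g q) -> 'D_v f p = 'D_v g p.
Proof. by move=> oD Dp fg; apply: near_eq_derive; exact: near_eq_on Dp fg. Qed.

Lemma eq_on_continuous D f g (p : V) : open D -> D p ->
  (forall q, D q -> f q = g q) -> {for p, continuous f} -> {for p, continuous g}.
Proof.
move=> oD Dp fg cf; rewrite /prop_for /continuous_at -(fg _ Dp).
apply: cvg_trans cf; apply: near_eq_cvg; exact: near_eq_on Dp fg.
Qed.

Lemma is_Ck_continuous n D f p : is_Ck n D f -> D p -> {for p, continuous f}.
Proof. by case: n => [|n] [cf _]; exact: cf. Qed.

Lemma is_CkS_derive n D f p v : is_Ck n.+1 D f -> D p -> is_derive p v f ('D_v f p).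
Proof. by move=> [_ /(_ v) [df _]] /df; exact: derivableP. Qed.

Lemma eq_on_is_Ck n D f g : open D -> (forall q, D q -> f q = g q) ->
  is_Ck n D f -> is_Ck n D g.
Proof.
move=> oD; elim: n f g => [|n IH] f g fg [cf df]; split.
- by move=> p Dp; apply: eq_on_continuous fg (cf _ Dp).
- by [].
- by move=> p Dp; apply: eq_on_continuous fg (cf _ Dp).
- move=> v; have [dfv Cf] := df v; split.
    by move=> p Dp; have [] := eq_on_is_derive oD Dp fg (derivableP (dfv _ Dp)).
  by apply: IH Cf => p Dp; exact: eq_on_derive Dp fg.
Qed.

(** Accepts any formula [df] for the derivatives on [D], so that the inductions for products,
    exponentials and inverses run on explicit expressions. *)
Lemma is_CkS n D f (df : V -> V -> R) : open D ->
  (forall p, D p -> {for p, continuous f}) ->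
  (forall v p, D p -> is_derive p v f (df v p)) ->
  (forall v, is_Ck n D (df v)) -> is_Ck n.+1 D f.
Proof.
move=> oD cf dfP Cdf; split=> // v; split=> [p /(dfP v)[]//|].
by apply: eq_on_is_Ck (Cdf v) => // p /(dfP v) [].
Qed.

Lemma is_CkW n D f : is_Ck n.+1 D f -> is_Ck n D f.
Proof.
elim: n f => [|n IH] f [cf df]; split => // v.
by have [dfv /IH] := df v.
Qed.

Lemma is_Ck_cst n D (c : R) : is_Ck n D (fun=> c).
Proof.
elim: n c => [|n IH] c; split => //.
- by move=> p _; exact: cvg_cst.
- by move=> p _; exact: cvg_cst.
- move=> v; split; first by move=> p _; exact: derivable_cst.
  by under eq_fun do rewrite derive_cst.
Qed.

Lemma is_CkD n D f g : open D -> is_Ck n D f -> is_Ck n D g ->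
  is_Ck n D (fun p => f p + g p).
Proof.
move=> oD; elim: n f g => [|n IH] f g Cf Cg.
  by split=> // p Dp; apply: cvgD;
    [exact: (is_Ck_continuous Cf Dp) | exact: (is_Ck_continuous Cg Dp)].
apply: (@is_CkS _ _ _ (fun v p => 'D_v f p + 'D_v g p)) => //.
- by move=> p Dp; apply: cvgD;
    [exact: (is_Ck_continuous Cf Dp) | exact: (is_Ck_continuous Cg Dp)].
- by move=> v p Dp; apply: is_deriveD;
    [exact: is_CkS_derive _ Cf Dp | exact: is_CkS_derive _ Cg Dp].
- by move=> v; apply: IH; [have [_ /(_ v) []] := Cf | have [_ /(_ v) []] := Cg].
Qed.

Lemma is_CkM n D f g : open D -> is_Ck n D f -> is_Ck n D g ->
  is_Ck n D (fun p => f p * g p).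
Proof.
move=> oD; elim: n f g => [|n IH] f g Cf Cg.
  by split=> // p Dp; apply: cvgM;
    [exact: (is_Ck_continuous Cf Dp) | exact: (is_Ck_continuous Cg Dp)].
apply: (@is_CkS _ _ _ (fun v p => f p * 'D_v g p + g p * 'D_v f p)) => //.
- by move=> p Dp; apply: cvgM;
    [exact: (is_Ck_continuous Cf Dp) | exact: (is_Ck_continuous Cg Dp)].
- by move=> v p Dp; apply: is_deriveM;
    [exact: is_CkS_derive _ Cf Dp | exact: is_CkS_derive _ Cg Dp].
- move=> v; apply: is_CkD => //; apply: IH.
  + exact: is_CkW.
  + by have [_ /(_ v) []] := Cg.
  + exact: is_CkW.
  + by have [_ /(_ v) []] := Cf.
Qed.

Lemma is_CkZ n D (c : R) f : open D -> is_Ck n D f -> is_Ck n D (fun p => c * f p).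
Proof. by move=> oD; apply: is_CkM => //; exact: is_Ck_cst. Qed.

Lemma is_CkB n D f g : open D -> is_Ck n D f -> is_Ck n D g ->
  is_Ck n D (fun p => f p - g p).
Proof.
move=> oD Cf Cg; apply: is_CkD => //.
by apply: eq_on_is_Ck (is_CkZ (-1) oD Cg) => // p _; rewrite mulN1r.
Qed.

Lemma is_Ck_sum n D (I : Type) (r : seq I) (F : I -> V -> R) : open D ->
  (forall i, is_Ck n D (F i)) -> is_Ck n D (fun p => \sum_(i <- r) F i p).
Proof.
move=> oD CF; elim: r => [|i r IH].
  by apply: eq_on_is_Ck (is_Ck_cst n D 0) => // p _; rewrite big_nil.
by apply: eq_on_is_Ck (is_CkD oD (CF i) IH) => // p _; rewrite big_cons.
Qed.

Lemma is_Ck_expR n D f : open D -> is_Ck n D f -> is_Ck n D (fun p => expR (f p)).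
Proof.
move=> oD; have cexp p : {for p, continuous f} ->
    {for p, continuous (fun q => expR (f q))}.
  by move=> cf; apply: (continuous_comp cf); exact: continuous_expR.
elim: n f cexp => [|n IH] f cexp Cf.
  by split=> // p Dp; apply: cexp; exact: (is_Ck_continuous Cf Dp).
apply: (@is_CkS _ _ _ (fun v p => expR (f p) * 'D_v f p)) => //.
- by move=> p Dp; apply: cexp; exact: (is_Ck_continuous Cf Dp).
- move=> v p Dp; apply: is_derive_comp1; exact: is_CkS_derive _ Cf Dp.
- move=> v; apply: is_CkM => //; first by apply: IH => //; exact: is_CkW.
  by have [_ /(_ v) []] := Cf.
Qed.

Lemma is_CkV n D f : open D -> (forall p, D p -> f p != 0) -> is_Ck n D f ->
  is_Ck n D (fun p => (f p)^-1).
Proof.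
move=> oD f0; elim: n => [|n IH] Cf.
  by split=> // p Dp; apply: cvgV; [exact: f0 | exact: (is_Ck_continuous Cf Dp)].
apply: (@is_CkS _ _ _ (fun v p => (-1 * ((f p)^-1 * (f p)^-1)) * 'D_v f p)) => //.
- by move=> p Dp; apply: cvgV; [exact: f0 | exact: (is_Ck_continuous Cf Dp)].
- move=> v p Dp; have [dfv _] := is_CkS_derive v Cf Dp.
  apply: DeriveDef; first by apply: derivableV => //; exact: f0.
  by rewrite deriveV ?f0// mulN1r -invfM -expr2.
- move=> v; apply: is_CkM => //.
    by apply: is_CkZ => //; apply: is_CkM => //; apply: IH; exact: is_CkW.
  by have [_ /(_ v) []] := Cf.
Qed.

Lemma is_derive_scalar (f : V -> R) (p v : V) : scalar f -> is_derive p v f (f v).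
Proof.
move=> lf; apply/is_derive_line0P.
have -> : (fun t : R => f (p + t *: v)) = (fun t => f p + t * f v).
  by apply/funext => t; rewrite addrC lf addrC.
by apply: is_derive_eq; rewrite /GRing.scale/=; ring.
Qed.

Lemma is_Ck_scalar n D f : open D -> scalar f -> continuous f -> is_Ck n D f.
Proof.
move=> oD lf cf; case: n => [|n]; first by split=> // p _; exact: cf.
apply: (@is_CkS _ _ _ (fun v _ => f v)) => //.
- by move=> p _; exact: cf.
- by move=> v p _; exact: is_derive_scalar.
- by move=> v; exact: is_Ck_cst.
Qed.

Lemma fst_coord_continuous (k : 'I_m) : continuous (fun p : V => p.1 0 k).
Proof.
move=> p; apply: (@continuous_comp _ _ _ fst (fun M : 'rV[R]_m => M 0 k)).
  exact: cvg_fst.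
exact: coord_continuous.
Qed.

Lemma snd_coord_continuous (k : 'I_m) : continuous (fun p : V => p.2 0 k).
Proof.
move=> p; apply: (@continuous_comp _ _ _ snd (fun M : 'rV[R]_m => M 0 k)).
  exact: cvg_snd.
exact: coord_continuous.
Qed.

Lemma is_Ck_snd_coord n D (k : 'I_m) : open D -> is_Ck n D (fun p => p.2 0 k).
Proof.
move=> oD; apply: is_Ck_scalar => //; last exact: snd_coord_continuous.
by move=> c u v; rewrite /= !mxE.
Qed.

End ClassCk.

(** * The Poincare lemma for closed one-forms *)

Section PoincareLemma.
Variables (R : realType) (m : nat).
Local Notation V := (cspace R m).
Local Notation J := ('I_m + 'I_m)%type.

Definition cspace_coord (i : J) (p : V) : R :=
  match i with inl k => p.1 0 k | inr k => p.2 0 k end.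

Definition cspace_basis (i : J) : V :=
  match i with inl k => (delta_mx 0 k, 0) | inr k => (0, delta_mx 0 k) end.

Lemma fst_sum (I : finType) (F : I -> V) : (\sum_i F i).1 = \sum_i (F i).1.
Proof. exact: (big_morph fst). Qed.

Lemma snd_sum (I : finType) (F : I -> V) : (\sum_i F i).2 = \sum_i (F i).2.
Proof. exact: (big_morph snd). Qed.

Lemma cspace_coordE (p : V) : p = \sum_i cspace_coord i p *: cspace_basis i.
Proof.
rewrite big_sumType/=; case: p => x y; congr pair.
- rewrite [RHS]/= !fst_sum /= [X in _ + X]big1 ?addr0; first exact: row_sum_delta.
  by move=> i _; rewrite /= scaler0.
- rewrite [RHS]/= !snd_sum /= [X in X + _]big1 ?add0r; first exact: row_sum_delta.
  by move=> i _; rewrite /= scaler0.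
Qed.

Lemma scalar_coordE (l : V -> R) (p : V) : scalar l ->
  l p = \sum_i cspace_coord i p * l (cspace_basis i).
Proof.
move=> ll; have l0 : l 0 = 0.
  by have := ll (-1) 0 0; rewrite scaler0 addr0 mulN1r addNr.
have lD u v : l (u + v) = l u + l v by have := ll 1 u v; rewrite scale1r mul1r.
rewrite {1}[p]cspace_coordE (big_morph l lD l0); apply: eq_bigr => i _.
by have := ll (cspace_coord i p) (cspace_basis i) 0; rewrite l0 !addr0.
Qed.

Lemma scalar_cspace_coord i : scalar (cspace_coord i).
Proof. by case: i => k c u v; rewrite /= !mxE. Qed.

Lemma cspace_coord_continuous i : continuous (cspace_coord i).
Proof.
by case: i => k; [exact: fst_coord_continuous | exact: snd_coord_continuous].
Qed.

Lemma sum_continuous (T : topologicalType) (I : finType) (F : I -> T -> R) (p : T) :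
  (forall i, {for p, continuous (F i)}) ->
  {for p, continuous (fun q => \sum_i F i q)}.
Proof.
move=> HF; elim: (index_enum I) => [|i r IH].
  rewrite (_ : (fun q => _) = (fun=> 0)); first exact: cvg_cst.
  by apply/funext => q; rewrite big_nil.
rewrite (_ : (fun q => _) = (fun q => F i q + \sum_(j <- r) F j q)).
  exact: cvgD (HF i) IH.
by apply/funext => q; rewrite big_cons.
Qed.

Lemma is_derive_sumr (I : finType) (F : I -> V -> R) (dF : I -> R) (p v : V) :
  (forall i, is_derive p v (F i) (dF i)) ->
  is_derive p v (fun q => \sum_i F i q) (\sum_i dF i).
Proof.
move=> HF; elim: (index_enum I) => [|i r IH].
  by rewrite big_nil; under eq_fun do rewrite big_nil; exact: is_derive_cst.
by rewrite big_cons; under eq_fun do rewrite big_cons; apply: is_deriveD.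
Qed.

Variables (D : set V) (p0 : V).
Hypothesis oD : open D.
Hypothesis starD : forall p (x : R), D p -> (itv01 R) x ->
  D (p0 + x *: (p - p0)).

Let gam (q : V) (x : R) : V := p0 + x *: (q - p0).

Let gam_continuous (q : V) (x : R) : (fun z : V * R => gam z.1 z.2) @ (q, x) --> gam q x.
Proof.
apply: cvgD; first exact: cvg_cst.
apply: cvgZ; first exact: (@cvg_snd _ _ (nbhs q) (nbhs x)).
by apply: cvgB; [exact: (@cvg_fst _ _ (nbhs q) (nbhs x)) | exact: cvg_cst].
Qed.

Let comp_gam_continuous (a : V -> R) q x : {for gam q x, continuous a} ->
  {for (q, x), continuous (fun z => a (gam z.1 z.2))}.
Proof. move=> ca A nA; exact: (@gam_continuous q x _ (ca A nA)). Qed.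

Let is_derive_gam_space (a : V -> R) (q v : V) (x d : R) :
  is_derive (gam q x) v a d -> is_derive q v (fun q => a (gam q x)) (x * d).
Proof.
move=> /is_derive_scaledir - /(_ x) /is_derive_line0P H; apply/is_derive_line0P.
rewrite (_ : (fun t : R => _) = (fun t => a (gam q x + t *: (x *: v))))//.
apply/funext => t; rewrite /gam [q + _ - _]addrAC scalerDr addrA.
by rewrite !scalerA [t * x]mulrC.
Qed.

Let is_derive_gam_time (a : V -> R) (q : V) (x d : R) :
  is_derive (gam q x) (q - p0) a d -> is_derive x 1 (fun x => a (gam q x)) d.
Proof. by move=> H; apply/(@is_derive_lineP _ _ _ a). Qed.

(** The primitive at [q] is the integral of [eta] along the segment from [p0] to [q]. Differentiated
    under the integral sign in the direction [v], its integrand becomes, by closedness, the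
    derivative in [x] of [x * eta (gam p x) v], which integrates to [eta p v]. *)
Theorem closed_form1_exact (eta : form1 R m) : smooth_form1 D eta ->
  (forall p, D p -> forall u v, ext_d1 eta p u v = 0) ->
  exists2 F : V -> R, smooth_on D F &
    forall p, D p -> forall v, is_derive p v F (eta p v).
Proof.
move=> [leta seta] deta.
have ceta v q : D q -> {for q, continuous (fun p => eta p v)}.
  by move=> Dq; exact: (is_Ck_continuous (seta v 0%N) Dq).
have dereta v u q : D q -> is_derive q u (fun p => eta p v) ('D_u (fun p => eta p v) q).
  by move=> Dq; exact: (is_CkS_derive u (seta v 1%N) Dq).
have cdereta v u q : D q -> {for q, continuous ('D_u (fun p => eta p v))}.
  by move=> Dq; have [_ /(_ u) [_ [H _]]] := seta v 1%N; exact: H.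
pose e i := cspace_basis i; pose phi i := cspace_coord i.
(* The integrand is [eta (gam q x) (q - p0)], expanded in coordinates because smoothness of [eta] is
   available only on constant tangent vectors while [q - p0] varies with [q]. *)
pose g q x := \sum_i phi i (q - p0) * eta (gam q x) (e i).
pose dg v q x := \sum_i (phi i (q - p0) * (x * 'D_v (fun p => eta p (e i)) (gam q x))
   + eta (gam q x) (e i) * phi i v).
have jphi i q x : {for (q, x), continuous (fun z : V * R => phi i (z.1 - p0))}.
  move=> A nA.
  have : (fun z : V * R => z.1 - p0) @ (q, x) --> q - p0.
    by apply: cvgB; [exact: (@cvg_fst _ _ (nbhs q) (nbhs x)) | exact: cvg_cst].
  by move=> cq; exact: (cq _ (cspace_coord_continuous nA)).
have cg q x : D q -> (itv01 R) x ->
    {for (q, x), continuous (fun z => g z.1 z.2)}.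
  move=> Dq Ix; apply: sum_continuous => i; apply: cvgM; first exact: jphi.
  by apply: (@comp_gam_continuous (fun p => eta p (e i))); apply: ceta; exact: starD.
have cdg v q x : D q -> (itv01 R) x ->
    {for (q, x), continuous (fun z => dg v z.1 z.2)}.
  move=> Dq Ix; apply: sum_continuous => i; apply: cvgD; apply: cvgM.
  - exact: jphi.
  - apply: cvgM; first exact: (@cvg_snd _ _ (nbhs q) (nbhs x)).
    apply: (@comp_gam_continuous ('D_v (fun p => eta p (e i)))).
    by apply: cdereta; exact: starD.
  - by apply: (@comp_gam_continuous (fun p => eta p (e i))); apply: ceta; exact: starD.
  - exact: cvg_cst.
have cgx q x : D q -> (itv01 R) x -> {for x, continuous (g q)}.
  by move=> Dq Ix A nA; exact: (pair_continuousr (cg q x Dq Ix A nA)).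
have dgP v q x : D q -> (itv01 R) x ->
    is_derive q v (g^~ x) (dg v q x).
  move=> Dq Ix; apply: is_derive_sumr => i.
  apply: is_deriveM; last first.
    by apply: (@is_derive_gam_space (fun p => eta p (e i))); apply: dereta; exact: starD.
  apply/is_derive_line0P.
  have -> : (fun t : R => phi i (q + t *: v - p0)) = (fun t => phi i ((q - p0) + t *: v)).
    by apply/funext => t; rewrite addrAC.
  apply/(@is_derive_line0P _ _ _ (phi i)); apply: is_derive_scalar.
  exact: scalar_cspace_coord.
have dF p v : D p -> is_derive p v (fun q => int01 (g q)) (eta p v).
  move=> Dp; have -> : eta p v = int01 (dg v p).
    have -> : eta p v = 1 * eta (gam p 1) v - 0 * eta (gam p 0) v.
      by rewrite mul0r subr0 mul1r /gam scale1r addrC subrK.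
    apply/esym/(@int01_derive _ (fun x => x * eta (gam p x) v)).
      move=> x Ix; have Dg : D (gam p x) by exact: starD.
      have -> : dg v p x = x * 'D_(p - p0) (fun q => eta q v) (gam p x) + eta (gam p x) v.
        rewrite /dg big_split/=; congr (_ + _); last first.
          rewrite (scalar_coordE v (leta _ Dg)).
          by apply: eq_bigr => i _; rewrite mulrC.
        have /eqP := deta _ Dg (p - p0) v; rewrite /ext_d1 subr_eq0 => /eqP ->.
        have /(_ v) [_ ->] : forall v, is_derive (gam p x) v
            (fun q => eta q (p - p0))
            (\sum_i phi i (p - p0) * 'D_v (fun q => eta q (e i)) (gam p x)).
          move=> u; apply: (eq_on_is_derive oD Dg
            (f := fun q => \sum_i phi i (p - p0) * eta q (e i))).
            by move=> q Dq; rewrite -scalar_coordE//; exact: leta.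
          apply: is_derive_sumr => i; apply: is_deriveZ; exact: dereta.
        by rewrite mulr_sumr; apply: eq_bigr => i _; rewrite mulrCA.
      have := is_derive_gam_time (dereta v (p - p0) _ Dg).
      move=> /(is_deriveM (is_derive_id x 1)) /= H.
      apply: is_derive_eq; rewrite /GRing.scale/=; ring.
    move=> x Ix A nA; exact: (pair_continuousr (cdg v p x Dp Ix A nA)).
  exact: (is_derive_int01 oD Dp cgx (dgP v) (cdg v)).
exists (fun q => int01 (g q)); last by move=> p Dp v; exact: dF.
have cF p : D p -> {for p, continuous (fun q => int01 (g q))}.
  move=> Dp; apply: int01_continuous; first by move=> x; exact: cg.
  by apply: filterS (open_nbhs_nbhs (conj oD Dp)) => q Dq x; exact: cgx.
case=> [|n]; first by split.
apply: (@is_CkS _ _ _ _ _ (fun v p => eta p v)) => [||v].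
- exact: oD.
- exact: cF.
- exact: seta.
Qed.

End PoincareLemma.

(** * Averages along periods *)

Section LineAverages.
Variables (R : realType) (m : nat).
Local Notation V := (cspace R m).
Variable D : set V.
Hypothesis oD : open D.

Definition line_invariant (e : V) := forall p (x : R), D p -> D (p + x *: e).

Definition average (e : V) (G : V -> R) (p : V) : R :=
  int01 (fun x => G (p + x *: e)).

Let line_continuous (e : V) (q : V) (x : R) :
  (fun z : V * R => z.1 + z.2 *: e) @ (q, x) --> q + x *: e.
Proof.
apply: cvgD; first exact: (@cvg_fst _ _ (nbhs q) (nbhs x)).
apply: cvgZr_tmp; exact: (@cvg_snd _ _ (nbhs q) (nbhs x)).
Qed.

Let jcont (e : V) (G : V -> R) (q : V) (x : R) : {for q + x *: e, continuous G} ->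
  {for (q, x), continuous (fun z : V * R => G (z.1 + z.2 *: e))}.
Proof. by move=> cG A nA; exact: (@line_continuous e q x _ (cG A nA)). Qed.

Let lcont (e : V) (G : V -> R) (q : V) (x : R) : {for q + x *: e, continuous G} ->
  {for x, continuous (fun x : R => G (q + x *: e))}.
Proof.
by move=> /jcont cG A nA; exact: (pair_continuousr (cG A nA)).
Qed.

Lemma eq_on_average e (G H : V -> R) p : line_invariant e -> D p ->
  (forall q, D q -> G q = H q) -> average e G p = average e H p.
Proof. by move=> De Dp GH; apply: eq_int01 => x _; apply: GH; exact: De. Qed.

Lemma averageB e n (G H : V -> R) p : line_invariant e -> D p ->
  is_Ck n D G -> is_Ck n D H ->
  average e (fun q => G q - H q) p = average e G p - average e H p.
Proof.
by move=> De Dp CG CH; apply: int01B => x _; apply: lcont;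
  [apply: (is_Ck_continuous CG) | apply: (is_Ck_continuous CH)]; exact: De.
Qed.

Lemma average_ge e n (G : V -> R) p (c : R) : line_invariant e -> D p ->
  is_Ck n D G -> (forall x, c <= G (p + x *: e)) -> c <= average e G p.
Proof.
move=> De Dp CG cG; rewrite -[c]int01_cst; apply: le_int01 => x _.
- exact: cvg_cst.
- by apply: lcont; apply: (is_Ck_continuous CG); exact: De.
- exact: cG.
Qed.

Lemma is_derive_average e n (G : V -> R) p v : line_invariant e -> D p ->
  is_Ck n.+1 D G -> is_derive p v (average e G) (average e ('D_v G) p).
Proof.
move=> De Dp CG; have [_ /(_ v) [_ CDG]] := CG.
have cg q x : D q -> (itv01 R) x ->
    {for x, continuous (fun x : R => G (q + x *: e))}.
  by move=> Dq _; apply: lcont; apply: (is_Ck_continuous CG); exact: De.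
have dg q x : D q -> (itv01 R) x ->
    is_derive q v (fun q => G (q + x *: e)) ('D_v G (q + x *: e)).
  move=> Dq _; apply/is_derive_line0P.
  rewrite (_ : (fun t : R => _) = (fun t => G (q + x *: e + t *: v))); last first.
    by apply/funext => t; rewrite addrAC.
  apply/(@is_derive_line0P _ _ _ G); apply: (is_CkS_derive _ CG); exact: De.
have cdg q x : D q -> (itv01 R) x ->
    {for (q, x), continuous (fun z : V * R => 'D_v G (z.1 + z.2 *: e))}.
  by move=> Dq _; apply: (@jcont e ('D_v G)); apply: (is_Ck_continuous CDG); exact: De.
exact (is_derive_int01 oD Dp cg dg cdg).
Qed.

Lemma is_Ck_average e n (G : V -> R) : line_invariant e ->
  is_Ck n D G -> is_Ck n D (average e G).
Proof.
move=> De; have ca k H p : is_Ck k D H -> D p -> {for p, continuous (average e H)}.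
  move=> CH Dp.
  have c1 (x : R) : (itv01 R) x ->
      {for (p, x), continuous (fun z : V * R => H (z.1 + z.2 *: e))}.
    by move=> _; apply: jcont; apply: (is_Ck_continuous CH); exact: De.
  refine (int01_continuous c1 _).
  apply: filterS (open_nbhs_nbhs (conj oD Dp)) => q Dq x _.
  by apply: lcont; apply: (is_Ck_continuous CH); exact: De.
elim: n G => [|n IH] G CG; first by split=> // p; exact: ca CG.
apply: (@is_CkS _ _ _ _ _ (fun v => average e ('D_v G))) => //.
- by move=> p; exact: ca CG.
- by move=> v p Dp; exact: is_derive_average CG.
- by move=> v; apply: IH; have [_ /(_ v) []] := CG.
Qed.

Lemma average_periodic e f (G : V -> R) : line_invariant e ->
  (forall p, D p -> G (p + f) = G p) ->
  forall p, D p -> average e G (p + f) = average e G p.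
Proof.
by move=> De Gf p Dp; apply: eq_int01 => x _; rewrite addrAC Gf//; exact: De.
Qed.

(* The derivative of [average e G] along [e] integrates [D_e G] over a period. *)
Lemma average_invariant e (G : V -> R) : line_invariant e -> is_Ck 1 D G ->
  (forall p, D p -> G (p + e) = G p) ->
  forall p (x : R), D p -> average e G (p + x *: e) = average e G p.
Proof.
move=> De CG Ge.
have dG q : D q -> is_derive q e (average e G) 0.
  move=> Dq; have := is_derive_average e De Dq CG.
  suff -> : average e ('D_e G) q = 0 by [].
  have dl (x : R) : (itv01 R) x ->
      is_derive x 1 (fun x => G (q + x *: e)) ('D_e G (q + x *: e)).
    by move=> _; apply/(@is_derive_lineP _ _ _ G); apply: (is_CkS_derive _ CG); exact: De.
  have cl (x : R) : (itv01 R) x ->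
      {for x, continuous (fun x : R => 'D_e G (q + x *: e))}.
    move=> _; apply: (@lcont e ('D_e G)); have [_ /(_ e) [_ [H _]]] := CG.
    by apply: H; exact: De.
  by rewrite /average (int01_derive dl cl) scale1r scale0r addr0 Ge// subrr.
move=> p x Dp; apply: constant_on_segment => y _.
rewrite scalerA -[X in is_derive _ _ _ X](mulr0 x).
by apply: is_derive_scaledir; apply: dG; exact: De.
Qed.

(** The head of the list is the outermost integral. For linearly independent periods of [G] this is
    the mean of [G] over the torus leaf through the point. *)
Definition iter_average (es : seq V) (G : V -> R) : V -> R := foldr average G es.

Definition line_invariant_seq (es : seq V) := forall e, e \in es -> line_invariant e.

Let consP e es : line_invariant_seq (e :: es) ->
  line_invariant e /\ line_invariant_seq es.
Proof.
move=> H; split; first by apply: H; rewrite mem_head.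
by move=> f fes; apply: H; rewrite in_cons fes orbT.
Qed.

Lemma is_Ck_iter_average es n (G : V -> R) : line_invariant_seq es ->
  is_Ck n D G -> is_Ck n D (iter_average es G).
Proof.
move=> + CG; elim: es => //= e r IH /consP[einv rinv].
by apply: is_Ck_average => //; exact: IH.
Qed.

Lemma eq_on_iter_average es (G H : V -> R) p : line_invariant_seq es -> D p ->
  (forall q, D q -> G q = H q) -> iter_average es G p = iter_average es H p.
Proof.
move=> + + GH; elim: es p => [|e r IH] p; first by move=> _; exact: GH.
by move=> /consP[einv rinv] Dp; apply: eq_on_average => // q Dq; exact: IH.
Qed.

Lemma is_derive_iter_average es n (G : V -> R) p v : line_invariant_seq es -> D p ->
  is_Ck n.+1 D G -> is_derive p v (iter_average es G) (iter_average es ('D_v G) p).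
Proof.
move=> + + CG; elim: es p => [|e r IH] p.
  by move=> _ Dp; exact: is_CkS_derive CG Dp.
move=> /consP[einv rinv] Dp.
apply: (is_derive_eq (is_derive_average v einv Dp (is_Ck_iter_average rinv CG))).
apply: eq_on_average => // q Dq.
by have [] := IH q rinv Dq.
Qed.

Lemma iter_averageB es n (G H : V -> R) p : line_invariant_seq es -> D p ->
  is_Ck n D G -> is_Ck n D H ->
  iter_average es (fun q => G q - H q) p = iter_average es G p - iter_average es H p.
Proof.
move=> + + CG CH; elim: es p => //= e r IH p /consP[einv rinv] Dp.
rewrite -(@averageB _ n)//; last 2 first.
- exact: is_Ck_iter_average.
- exact: is_Ck_iter_average.
by apply: eq_on_average => // q Dq; exact: IH.
Qed.

(** [T] stands for the leaf through [p]. The average sees [G] only there, and the lower bounds to be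
    averaged hold on one leaf rather than on all of [D]. *)
Lemma iter_average_ge es n (G : V -> R) (T : set V) p (c : R) :
  line_invariant_seq es -> D p -> is_Ck n D G ->
  T p -> (forall q e (x : R), e \in es -> T q -> T (q + x *: e)) ->
  (forall q, T q -> c <= G q) -> c <= iter_average es G p.
Proof.
move=> + + CG + + cG; elim: es p => [|e r IH] p; first by move=> _ _ Tp _; exact: cG.
move=> /consP[einv rinv] Dp Tp Tes.
apply: (@average_ge _ n) => //; first exact: is_Ck_iter_average.
move=> x; apply: IH => //; first exact: einv.
  by apply: Tes => //; rewrite mem_head.
by move=> q f y fr; apply: Tes; rewrite in_cons fr orbT.
Qed.

Lemma iter_average_periodic es f (G : V -> R) p : line_invariant_seq es ->
  (forall p, D p -> G (p + f) = G p) -> D p ->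
  iter_average es G (p + f) = iter_average es G p.
Proof.
move=> + Gf; elim: es p => [|e r IH] p; first by move=> _; exact: Gf.
by move=> /consP[einv rinv] Dp; apply: average_periodic => // q Dq; exact: IH.
Qed.

(** The integral along [e] itself creates the invariance; the integrals inside it keep the integrand
    periodic under [e], and those outside it commute with translations. *)
Lemma iter_average_invariant es (G : V -> R) e p (x : R) : line_invariant_seq es ->
  is_Ck 1 D G -> (forall e p, e \in es -> D p -> G (p + e) = G p) ->
  e \in es -> D p -> iter_average es G (p + x *: e) = iter_average es G p.
Proof.
move=> + CG; elim: es p x => // f r IH p x /consP[finv rinv] per.
have rper g q : g \in r -> D q -> G (q + g) = G q.
  by move=> gr; apply: per; rewrite in_cons gr orbT.
rewrite in_cons => /predU1P[-> | er] Dp.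
  have perf q : D q -> iter_average r G (q + f) = iter_average r G q.
    apply: iter_average_periodic rinv _ => q' Dq'.
    by apply: per => //; exact: mem_head.
  exact: (average_invariant finv (is_Ck_iter_average rinv CG) perf _ Dp).
by apply: average_periodic => // q Dq; exact: IH.
Qed.

Definition real_span (n : nat) (e : 'I_n -> V) : set V :=
  [set v | exists l : 'I_n -> R, v = \sum_i l i *: e i].

Lemma iter_average_real_span n (e : 'I_n -> V) (G : V -> R) p v :
  line_invariant_seq (codom e) -> is_Ck 1 D G ->
  (forall i p, D p -> G (p + e i) = G p) ->
  real_span e v -> D p ->
  iter_average (codom e) G (p + v) = iter_average (codom e) G p.
Proof.
move=> einv CG per [l ->]; elim: (index_enum _) p => [|i r IH] p Dp.
  by rewrite big_nil addr0.
rewrite big_cons addrA IH; last by apply: einv => //; exact: codom_f.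
apply: iter_average_invariant => //; last exact: codom_f.
by move=> _ q /codomP[j ->]; exact: per.
Qed.

(* Averaging kills the derivatives of a closed form in the averaged directions, so
   closedness leaves only the derivative of the [a, b]-coefficient. *)
Lemma average_closed_form2 n (e : 'I_n -> V) (w : form2 R m) (a b : V) :
  line_invariant_seq (codom e) ->
  (forall u v, is_Ck 1 D (fun p => w p u v)) ->
  (forall p, D p -> forall x y z, ext_d2 w p x y z = 0) ->
  (forall i p u v, D p -> w (p + e i) u v = w p u v) ->
  real_span e a -> real_span e b ->
  (forall p q (x : R), D p -> D q -> 0 <= x <= 1 -> D (p + x *: (q - p))) ->
  forall p q, D p -> D q ->
  iter_average (codom e) (fun p => w p a b) q =
  iter_average (codom e) (fun p => w p a b) p.
Proof.
move=> einv Cw dw per sa sb convD p q Dp Dq.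
have A0 u v c z : real_span e c -> D z ->
    iter_average (codom e) ('D_c (fun p => w p u v)) z = 0.
  move=> sc Dz; have [_ <-] := is_derive_iter_average c einv Dz (Cw u v).
  pose AG := iter_average (codom e) (fun p => w p u v).
  suff: is_derive (0 : R) 1 (fun t => AG (z + t *: c)) 0.
    by move=> /(@is_derive_line0P _ _ _ AG) [_ ->].
  rewrite (_ : (fun t : R => _) = cst (AG z)).
    exact: is_derive_cst.
  apply/funext => t; apply: iter_average_real_span => //.
    by move=> i y; exact: per.
  have [l ->] := sc; exists (fun i => t * l i).
  by rewrite scaler_sumr; apply: eq_bigr => i _; rewrite scalerA.
have CD c u v : is_Ck 0 D ('D_c (fun p => w p u v)).
  by have [_ /(_ c) []] := Cw u v.
rewrite -[q in LHS](subrK p) addrC; apply: constant_on_segment => x x01.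
have Dx : D (p + x *: (q - p)) by exact: convD.
apply: (is_derive_eq (is_derive_iter_average (q - p) einv Dx (Cw a b))).
pose Ga := 'D_a (fun z => w z (q - p) b); pose Gb := 'D_b (fun z => w z (q - p) a).
rewrite (eq_on_iter_average (H := fun z => Ga z - Gb z) einv Dx); last first.
  move=> z Dz; have := dw z Dz (q - p) a b; rewrite /ext_d2 /Ga /Gb => /eqP.
  by rewrite -addrA addr_eq0 => /eqP ->; rewrite opprD opprK.
rewrite (iter_averageB einv Dx (CD _ _ _ : is_Ck 0 D Ga) (CD _ _ _ : is_Ck 0 D Gb)).
by rewrite /Ga /Gb !A0// subrr.
Qed.

End LineAverages.

(** * Scaling of a closed periodic two-form by an affine map *)

Section PeriodicScaling.
Variables (R : realType) (m : nat).
Local Notation V := (cspace R m).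
Variables (D : set V) (n : nat) (e : 'I_n -> V).
Hypothesis oD : open D.
Hypothesis De : forall i, line_invariant D (e i).

Let line_invariant_codom : line_invariant_seq D (codom e).
Proof. by move=> _ /codomP[i ->]; exact: De. Qed.

Lemma real_spanD (u v : V) : real_span e u -> real_span e v -> real_span e (u + v).
Proof.
move=> [l ->] [l' ->]; exists (fun i => l i + l' i).
by rewrite -big_split; apply: eq_bigr => i _; rewrite scalerDl.
Qed.

Lemma real_spanZ (x : R) (v : V) : real_span e v -> real_span e (x *: v).
Proof.
move=> [l ->]; exists (fun i => x * l i).
by rewrite scaler_sumr; apply: eq_bigr => i _; rewrite scalerA.
Qed.

Lemma real_span_gen i : real_span e (e i).
Proof.
exists (fun j => (j == i)%:R); rewrite (bigD1 i)//= eqxx scale1r big1 ?addr0//.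
by move=> j /negPf ->; rewrite scale0r.
Qed.

Let D_sum (p : V) (l : 'I_n -> R) (r : seq 'I_n) : D p ->
  D (p + \sum_(i <- r) l i *: e i).
Proof.
elim: r p => [|i r IH] p Dp; first by rewrite big_nil addr0.
by rewrite big_cons addrA; apply: IH; exact: De.
Qed.

Lemma real_span_invariant p v : D p -> real_span e v -> D (p + v).
Proof. by move=> Dp [l ->]; exact: D_sum. Qed.

(* A continuous positive function periodic under [e] is bounded below on the
   affine span, since the span is covered by translates of a compact cell. *)
Lemma periodic_lower_bound (G : V -> R) p :
  (forall q, D q -> {for q, continuous G}) ->
  (forall i q, D q -> G (q + e i) = G q) ->
  (forall q, D q -> 0 < G q) -> D p ->
  exists2 c : R, 0 < c & forall v, real_span e v -> c <= G (p + v).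
Proof.
move=> cG per posG Dp.
have perN i (c : nat) q : D q -> G (q + c%:R *: e i) = G q.
  move=> Dq; elim: c => [|c IH]; first by rewrite scale0r addr0.
  by rewrite -natr1 scalerDl scale1r addrA per//; exact: De.
have perz i (c : int) q : D q -> G (q + c%:~R *: e i) = G q.
  case: c => c Dq; first exact: perN.
  have Dq' : D (q - c.+1%:R *: e i) by rewrite -scaleNr; exact: De.
  by rewrite NegzE mulrNz scaleNr -pmulrn -(perN i c.+1 _ Dq') subrK.
have perS (k : 'I_n -> int) q : D q -> G (q + \sum_i (k i)%:~R *: e i) = G q.
  elim: (index_enum _) q => [|i r IH] q Dq; first by rewrite big_nil addr0.
  by rewrite big_cons addrA IH ?perz//; exact: De.
pose box := [set x : 'rV[R]_n | forall i, (itv01 R) (x 0 i)].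
have cbox : compact box.
  apply: (@rV_compact _ _ (fun=> (itv01 R))) => i.
  exact: segment_compact.
pose f (x : 'rV[R]_n) := G (p + \sum_i x 0 i *: e i).
have cf : continuous f.
  move=> x; have Dx : D (p + \sum_i x 0 i *: e i) by exact: D_sum.
  pose S (r : seq 'I_n) (y : 'rV[R]_n) : V := p + \sum_(i <- r) y 0 i *: e i.
  have cS (r : seq 'I_n) : {for x, continuous (S r)}.
    elim: r => [|i r IH].
      rewrite (_ : S [::] = fun=> p); first exact: cst_continuous.
      by apply/funext => y; rewrite /S big_nil addr0.
    rewrite (_ : S (i :: r) = fun y => S r y + y 0 i *: e i).
      by apply: cvgD IH _; apply: cvgZr_tmp; exact: coord_continuous.
    by apply/funext => y; rewrite /S big_cons addrAC addrA.
  by move=> A nA; exact: (cS (index_enum 'I_n) _ (cG _ Dx A nA)).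
have [|x0 _ x0min] := EVT_min_rV _ cbox (continuous_subspaceT cf).
  by exists 0 => i; rewrite mxE; apply/in01P; rewrite lexx ler01.
exists (f x0); first by apply: posG; exact: D_sum.
move=> _ [l ->].
pose x := \row_i (l i - (Num.floor (l i))%:~R).
have -> : G (p + \sum_i l i *: e i) = f x.
  rewrite /f -[RHS](perS (fun i => Num.floor (l i))); last exact: D_sum.
  rewrite -addrA -big_split/=; congr (G (p + _)); apply: eq_bigr => i _.
  by rewrite mxE -scalerDl subrK.
apply: x0min; rewrite inE => i; rewrite mxE; apply/in01P.
have /andP[fl fu] := floor_itv (l i).
by rewrite subr_ge0 fl/= lerBlDl ltW// -(intrD _ _ 1).
Qed.

(** Since [L] maps onto the span, each point [T p + v] of the leaf through [T p] is the image of a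
    point of the leaf through [p]. A lower bound on one leaf thus becomes [q] times that bound on
    the next, whereas the average is the same on all leaves. *)
Theorem periodic_scaling_le1 (w : form2 R m) (a b : V) (T : V -> V) (L : V -> V)
    (q : R) (p0 : V) :
  (forall u v, is_Ck 1 D (fun p => w p u v)) ->
  (forall p, D p -> forall x y z, ext_d2 w p x y z = 0) ->
  (forall i p u v, D p -> w (p + e i) u v = w p u v) ->
  (forall p q (x : R), D p -> D q -> 0 <= x <= 1 -> D (p + x *: (q - p))) ->
  real_span e a -> real_span e b -> D p0 ->
  (forall p, D p -> 0 < w p a b) ->
  (forall p, D p -> D (T p)) ->
  (forall p v, T (p + v) = T p + L v) ->
  (forall v, real_span e v -> exists2 v', real_span e v' & v = L v') ->
  (forall p, D p -> w (T p) a b = q * w p a b) ->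
  q <= 1.
Proof.
move=> Cw dw per convD sa sb Dp0 pos DT TL Lspan wT.
have cw p : D p -> {for p, continuous (fun p => w p a b)}.
  exact: is_Ck_continuous (Cw a b).
have [c c0 cG] := periodic_lower_bound cw (fun i p => per i p a b) pos Dp0.
have q0 : 0 < q.
  by have := pos _ (DT _ Dp0); rewrite wT// pmulr_lgt0//; exact: pos.
pose A := iter_average (codom e) (fun p => w p a b).
have lowA p x : D p -> (forall v, real_span e v -> x <= w (p + v) a b) -> x <= A p.
  move=> Dp xw.
  apply: (@iter_average_ge _ _ _ oD _ 1 _ (fun z => real_span e (z - p))) => //.
  - by rewrite subrr; exists (fun=> 0); rewrite big1// => i _; rewrite scale0r.
  - move=> z _ y /codomP[i ->] sz; rewrite addrAC; apply: real_spanD => //.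
    by apply: real_spanZ; exact: real_span_gen.
  - by move=> z /xw; rewrite addrC subrK.
(* The witness is the [k]-th image of [p0] under [T]; constancy of the average brings the bound
   obtained there back to [p0]. *)
have powA k : q ^+ k * c <= A p0.
  have [p Dp pc] : exists2 p, D p &
      forall v, real_span e v -> q ^+ k * c <= w (p + v) a b.
    elim: k => [|k [p Dp pc]]; first by exists p0 => // v /cG; rewrite expr0 mul1r.
    exists (T p); first exact: DT.
    move=> v /Lspan [v' sv' ->]; rewrite -TL wT; last exact: real_span_invariant.
    by rewrite exprS -mulrA ler_pM2l//; exact: pc.
  apply: le_trans (lowA _ _ Dp pc) _.
  rewrite /A.
  by rewrite (average_closed_form2 oD line_invariant_codom Cw dw per sa sb convD Dp0 Dp).
rewrite leNgt; apply/negP => q1.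
(* Bernoulli's inequality, which with the archimedean property makes [q ^+ k * c] exceed the fixed
   number [A p0] when [q > 1]. *)
have bern k : 1 + k%:R * (q - 1) <= q ^+ k.
  elim: k => [|k IH]; first by rewrite mul0r addr0 expr0.
  rewrite exprS; apply: le_trans (ler_wpM2l (ltW q0) IH).
  have k0 : 0 <= k%:R :> R by rewrite ler0n.
  rewrite -natr1 -subr_ge0 (_ : _ - _ = k%:R * (q - 1) ^+ 2); last by ring.
  by rewrite mulr_ge0// sqr_ge0.
have q10 : 0 < c * (q - 1) by rewrite mulr_gt0// subr_gt0.
have A0 : 0 <= A p0 / (c * (q - 1)).
  by rewrite divr_ge0 ?(ltW q10)//; apply: le_trans (powA 0%N); rewrite expr0 mul1r ltW.
have := archi_boundP A0; rewrite ltr_pdivrMr//; set k := Num.bound _ => kA.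
have := powA k; rewrite leNgt => /negP; apply.
apply: lt_le_trans kA _; rewrite mulrCA mulrC ler_pM2r//.
by apply: le_trans (bern k); rewrite lerDr ler01.
Qed.

End PeriodicScaling.

(** * Embeddings of a number field *)

Section EmbeddingExtension.
Variables (K : fieldExtType rat) (C : numFieldType).
Local Notation toK := (map_poly (in_alg K)).
Local Notation toC := (map_poly (ratr : rat -> C)).

(** Primitive element theorem in characteristic zero. [q] is the minimal polynomial of [theta]
    descended to rational coefficients; its minimality is recorded as divisibility, the form in
    which it is used. *)
Lemma primitive_element_rat : exists theta : K, exists q : {poly rat},
  [/\ separable_poly q, root (toK q) theta,
      forall p, root (toK p) theta -> q %| p &
      forall a : K, exists p, a = (toK p).[theta]].
Proof.
have char0 : [pchar K] =i pred0.
  move=> p; rewrite !inE; apply/negP => /andP[p_pr /eqP p0].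
  have : (p%:R : rat) == 0.
    by rewrite -(fmorph_eq0 (in_alg K)) rmorph_nat p0.
  by rewrite pnatr_eq0; case: p p_pr {p0}.
set theta := separable_generator (1%AS : {subfield K}) (fullv : {vspace K}).
have full : (fullv : {vspace K}) = <<1%AS; theta>>%VS.
  apply: eq_adjoin_separable_generator; last exact: subvf.
  by apply/separableP => y _; exact: pcharf0_separable.
have /polyOver1P[q qE] := minPolyOver (1%AS : {subfield K}) theta.
exists theta, q; split.
- by rewrite -(separable_map (in_alg K)) -qE; exact: pcharf0_separable.
- by rewrite -qE root_minPoly.
- move=> p p0; rewrite -(dvdp_map (in_alg K)) -qE.
  by apply: minPoly_dvdp => //; apply/polyOver1P; exists p.
- move=> a; have : a \in <<1%AS; theta>>%VS by rewrite -full memvf.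
  by move=> /Fadjoin_polyP[_ /polyOver1P[p ->] ->]; exists p.
Qed.

Variables (theta : K) (q : {poly rat}) (rho : C).
Hypothesis q_dvd : forall p, root (toK p) theta -> q %| p.
Hypothesis theta_gen : forall a : K, exists p, a = (toK p).[theta].
Hypothesis q_rho : root (toC q) rho.

Let rep (a : K) : {poly rat} := sval (cid (theta_gen a)).

Definition embedding_of_root (a : K) : C := (toC (rep a)).[rho].

(** Two polynomials representing the same element differ by a multiple of [q], which vanishes at
    [rho]; so the value is independent of the chosen representative, and the morphism laws follow
    from those of evaluation. *)
Lemma embedding_of_rootE p : embedding_of_root (toK p).[theta] = (toC p).[rho].
Proof.
rewrite /embedding_of_root; set a := (toK p).[theta].
have /q_dvd qd : root (toK (rep a - p)) theta.
  rewrite /root rmorphB hornerD hornerN subr_eq0.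
  by rewrite -(svalP (cid (theta_gen a))).
have : root (toC (rep a - p)) rho.
  by apply: root_dvdp q_rho; rewrite dvdp_map.
by rewrite /root rmorphB hornerD hornerN subr_eq0 => /eqP.
Qed.

Fact embedding_of_root_zmod : zmod_morphism embedding_of_root.
Proof.
move=> a b; have [p ->] := theta_gen a; have [p' ->] := theta_gen b.
by rewrite -hornerN -hornerD -rmorphB !embedding_of_rootE rmorphB hornerD hornerN.
Qed.

Fact embedding_of_root_monoid : monoid_morphism embedding_of_root.
Proof.
split.
  have -> : 1 = (toK 1).[theta] by rewrite rmorph1 hornerC.
  by rewrite embedding_of_rootE rmorph1 hornerC.
move=> a b; have [p ->] := theta_gen a; have [p' ->] := theta_gen b.
by rewrite -hornerM -rmorphM !embedding_of_rootE rmorphM hornerM.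
Qed.

HB.instance Definition _ :=
  GRing.isZmodMorphism.Build K C embedding_of_root embedding_of_root_zmod.
HB.instance Definition _ :=
  GRing.isMonoidMorphism.Build K C embedding_of_root embedding_of_root_monoid.

Lemma exists_embedding : exists f : {rmorphism K -> C}, f theta = rho.
Proof.
exists embedding_of_root.
by have := embedding_of_rootE 'X; rewrite !map_polyX !hornerX.
Qed.

End EmbeddingExtension.

Lemma integral_int_multiple (K : fieldExtType rat) (theta : K) (p : {poly rat}) :
  p != 0 -> root (map_poly (in_alg K) p) theta ->
  exists2 c : int, c != 0 & integralOver (intr : int -> K) (c%:~R * theta).
Proof.
move=> p0 rp; have [P [a a0 pP]] := rat_poly_scale p.
have P0 : P != 0.
  by apply: contraNneq p0 => P0; rewrite pP P0 rmorph0 scaler0.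
have rP : root (map_poly (intr : int -> K) P) theta.
  move: rp; rewrite pP linearZ/= -map_poly_comp rootZ; last first.
    by rewrite scaler_eq0 oner_eq0 orbF invr_eq0 intr_eq0.
  by rewrite (eq_map_poly (g := intr))// => z; exact: (rmorph_int (in_alg K)).
pose c : int := lead_coef P; pose N := (size P).-1.
have sP : size P = N.+1 by rewrite prednK// size_poly_gt0.
exists c; first by rewrite lead_coef_eq0.
(* For positive degree [N] this is c^(N-1) P(X / c): multiplying by c^(N-1) makes the polynomial of
   [c * theta] monic with integer coefficients. Degree zero is excluded separately, as a nonzero
   constant has no root. *)
pose S : {poly int} := 'X^N + \poly_(i < N) (P`_i * c ^+ (N.-1 - i)).
rewrite /integralOver; exists S.
  rewrite monicE lead_coefDl ?lead_coefXn// size_polyXn ltnS; exact: size_poly.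
rewrite /root rmorphD/= map_polyXn hornerD hornerXn.
rewrite (horner_coef_wide (n := N)); last first.
  by rewrite (leq_trans (size_poly _ _))// (leq_trans (size_poly _ _)).
have [N0|N0] := posnP N.
  move: rP; rewrite /root; have /size_poly1P[d d0 ->] : size P == 1%N by rewrite sP N0.
  rewrite map_polyC hornerC/= -(rmorph_int (in_alg K)) fmorph_eq0 intr_eq0.
  by rewrite (negPf d0).
have -> : \sum_(i < N) (map_poly intr (\poly_(i < N) (P`_i * c ^+ (N.-1 - i))))`_i
     * (c%:~R * theta) ^+ i =
   \sum_(i < N) (c%:~R ^+ N.-1 : K) * ((map_poly intr P)`_i * theta ^+ i).
  apply: eq_bigr => i _; rewrite !coef_map/= coef_poly ltn_ord rmorphM rmorphXn/=.
  have -> : (c%:~R ^+ N.-1 : K) = c%:~R ^+ (N.-1 - i) * c%:~R ^+ i.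
    by rewrite -exprD subnK// -ltnS prednK.
  by rewrite exprMn; ring.
rewrite -mulr_sumr.
move: rP; rewrite /root (horner_coef_wide (n := N.+1)); last first.
  by rewrite (leq_trans (size_poly _ _))// sP.
rewrite big_ord_recr/= addrC => /eqP /addr0_eq <-.
rewrite mulrN coef_map/= -/c (_ : P`_N = c); last by rewrite /c lead_coefE.
by rewrite mulrA -exprSr prednK// exprMn subrr.
Qed.

(** The integers are integrally closed. The fact is borrowed from [algC], where a rational algebraic
    integer is an integer. *)
Lemma integral_rat_int (d : rat) : integralOver (intr : int -> rat) d -> d \is a Num.int.
Proof.
move=> [p mp rp]; have : (ratr d : algC) \in Num.int.
  apply: Cint_rat_Aint; first exact: Crat_rat.
  apply: (@root_monic_Aint (map_poly intr p)).
  - move: rp; rewrite -(fmorph_root (ratr : {rmorphism rat -> algC})) -map_poly_comp.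
    by rewrite (eq_map_poly (g := intr))// => z /=; rewrite rmorph_int.
  - exact: monic_map.
  - by apply/polyOverP => i; rewrite coef_map/= intr_int.
move=> /intrP[z] /eqP; rewrite -(rmorph_int (ratr : {rmorphism rat -> algC})).
by rewrite (inj_eq (fmorph_inj _)) => /eqP ->.
Qed.

Lemma Vandermonde_unit (F : fieldType) n (x : 'rV[F]_n) :
  injective (x 0) -> Vandermonde n x \in unitmx.
Proof.
move=> injx; rewrite unitmxE det_Vandermonde unitfE.
apply/prodf_neq0 => i _; apply/prodf_neq0 => j ij.
by rewrite subr_eq0; apply: contraTneq ij => /injx ->; rewrite ltnn.
Qed.

(** * The norm as the product of all embeddings *)

Section Embeddings.
Variables (K : fieldExtType rat) (C : numClosedFieldType) (N : nat).
Variable sigma : 'I_N -> {rmorphism K -> C}.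
Hypothesis sigma_inj : forall i j, sigma i =1 sigma j -> i = j.
Hypothesis sigma_all : forall f : {rmorphism K -> C}, exists i, f =1 sigma i.
Local Notation toK := (map_poly (in_alg K)).
Local Notation toC := (map_poly (ratr : rat -> C)).

Let sigma_horner i p a : sigma i (toK p).[a] = (toC p).[sigma i a].
Proof.
rewrite -horner_map -map_poly_comp; congr (_.[_]); apply: eq_map_poly => x.
exact: (fmorph_eq_rat (sigma i \o in_alg K)).
Qed.

Lemma embeddings_separate (theta : K) :
  (forall a : K, exists p, a = (toK p).[theta]) ->
  injective (fun i => sigma i theta).
Proof.
move=> gen i j ij; apply: sigma_inj => a; have [p ->] := gen a.
by rewrite !sigma_horner ij.
Qed.

(** The product is the determinant of multiplication by [u] on powers of [theta], written as the
    rational matrix [M]: the Vandermonde matrix of the conjugates of [theta] intertwines [M] with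
    the diagonal matrix of the [sigma i u]. *)
Lemma prod_embeddings_rat (u : K) : exists d : rat, \prod_i sigma i u = ratr d.
Proof.
have [theta [q [sepq q0 q_dvd gen]]] := primitive_element_rat K.
have q_neq0 : q != 0.
  exact: separable_poly_neq0.
(* Each of the distinct roots of [q] is the image of [theta] under some embedding, so [q] has degree
   at most [N] and remainders modulo [q] fit into [N] coefficients. *)
have sq : (size q <= N.+1)%N.
  have [r Dr] := closed_field_poly_normal (toC q).
  have cq : lead_coef (toC q) != 0 by rewrite lead_coef_eq0 map_poly_eq0.
  have ur : uniq r.
    rewrite -separable_prod_XsubC -(eqp_separable (p := toC q)) ?separable_map//.
    by rewrite Dr; apply: eqp_scale.
  rewrite -(size_map_poly (ratr : {rmorphism rat -> C})) Dr size_scale//.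
  rewrite size_prod_XsubC ltnS.
  rewrite -[N]card_ord -(size_codom (fun i => sigma i theta)).
  apply: uniq_leq_size => // rho rr.
  have rq : root (toC q) rho by rewrite Dr rootZ// root_prod_XsubC.
  have [f <-] := exists_embedding q_dvd gen rq.
  have [i fi] := sigma_all f; rewrite fi; exact: codom_f.
have expand a : {p : {poly rat} | (size p <= N)%N & a = (toK p).[theta]}.
  apply: cid2; have [p ->] := gen a; exists (p %% q).
    by rewrite -ltnS (leq_trans _ sq)// ltn_modp.
  rewrite {1}(divp_eq p q) rmorphD rmorphM hornerD hornerM.
  by rewrite (eqP q0) mulr0 add0r.
pose P j := s2val (expand (theta ^+ j * u)).
pose M : 'M[rat]_N := \matrix_(j, k) (P j)`_k.
pose x : 'rV[C]_N := \row_i sigma i theta.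
pose W := Vandermonde N x.
have WM : W *m diag_mx (\row_i sigma i u) = map_mx ratr M *m W.
  apply/matrixP => j i; rewrite mul_mx_diag !mxE -rmorphXn -rmorphM.
  rewrite (s2valP' (expand (theta ^+ j * u))) sigma_horner.
  rewrite (horner_coef_wide (n := N)); last first.
    by rewrite size_map_poly; exact: (s2valP (expand (theta ^+ j * u))).
  by apply: eq_bigr => k _; rewrite coef_map !mxE.
have Wu : W \in unitmx.
  apply: Vandermonde_unit => i j; rewrite !mxE.
  exact: embeddings_separate.
exists (\det M); have := congr1 determinant WM.
rewrite !det_mulmx det_diag mulrC det_map_mx => /(mulIf _) <-.
  by apply: eq_bigr => i _; rewrite mxE.
by move: Wu; rewrite unitmxE unitfE.
Qed.

(** The product is rational and integral, hence an integer. The same holds for [u^-1], and the two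
    integers multiply to 1. *)
Lemma prod_embeddings_unit (u : K) : unit_of_integers u ->
  exists2 d : int, \prod_i sigma i u = d%:~R & d \is a GRing.unit.
Proof.
have intprod v : ring_of_integers v -> exists z : int, \prod_i sigma i v = z%:~R.
  move=> iv; have [d Ed] := prod_embeddings_rat v.
  suff /integral_rat_int /intrP[z dz] : integralOver (intr : int -> rat) d.
    by exists z; rewrite Ed dz rmorph_int.
  have : integralOver (intr : int -> C) (\prod_i sigma i v).
    elim/big_ind: _ => [|a b|i _].
    - exact: integral1.
    - exact: integral_mul.
    - have [p mp rp] := integral_rmorph (sigma i) iv.
      exists p => //; move: rp; rewrite (eq_map_poly (g := intr))// => z.
      exact: (rmorph_int (sigma i)).
  rewrite Ed => -[p mp rp]; exists p => //.
  rewrite -(fmorph_root (ratr : {rmorphism rat -> C})) -map_poly_comp.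
  rewrite [map_poly (_ \o _) _](eq_map_poly (g := intr))// => z /=.
  by rewrite rmorph_int.
move=> [u0 iu iv]; have [d Ed] := intprod _ iu; have [d' Ed'] := intprod _ iv.
exists d => //; apply/unitrP; exists d'.
have : (d * d')%:~R = 1 :> C.
  rewrite rmorphM/= -Ed -Ed' -big_split/= big1// => i _.
  by rewrite -rmorphM divff// rmorph1.
by move=> /(intr_inj (x2 := 1)) dd; rewrite mulrC dd.
Qed.

End Embeddings.

(** * Integers and units of an OT pair *)

Section OTNumberField.
Variables (R : realType) (s t : nat) (K : fieldExtType rat).
Variable sigma : 'I_(s + t + t) -> {rmorphism K -> R[i]}.
Hypothesis hsigma : embeddings_of_type sigma.
Local Notation V := (cspace R (s + t)).

Definition embedding_vector (a : K) : V :=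
  @Defs.cpoint R (s + t) (fun k => sigma (lshift t k) a).

Lemma ring_of_integers0 : ring_of_integers (0 : K).
Proof. exact: mxpoly.integral0. Qed.

Lemma ring_of_integersM (a b : K) :
  ring_of_integers a -> ring_of_integers b -> ring_of_integers (a * b).
Proof. exact: integral_mul. Qed.

Lemma ring_of_integersX (a : K) n : ring_of_integers a -> ring_of_integers (a ^+ n).
Proof.
move=> ia; elim: n => [|n IH]; first exact: integral1.
by rewrite exprS; exact: ring_of_integersM.
Qed.

Lemma conjc_sum (I : finType) (F : I -> R[i]) :
  (\sum_i F i)^* = \sum_i (F i)^*.
Proof. exact: (rmorph_sum (@conjc R)). Qed.

(** The elements are the powers of an integral multiple [al] of a primitive element. Writing [v] in
    them is interpolation at the conjugates of [al]: the data are the coordinates of [v] at the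
    first [s + t] embeddings and their conjugates at the last [t]. Conjugation permutes nodes and
    data alike, the data at real nodes being real by the hypothesis on [v], so it fixes the unique
    solution, whose coefficients are therefore real. *)
Lemma integers_real_span : exists e : 'I_(s + t + t) -> K,
  (forall i, ring_of_integers (e i)) /\
  forall v : V, (forall k : 'I_s, v.2 0 (lshift t k) = 0) ->
    real_span (fun i => embedding_vector (e i)) v.
Proof.
have [sinj sall sreal _ sconj] := hsigma.
have [theta [q [sepq q0 _ gen]]] := primitive_element_rat K.
have [c c0 ic] := integral_int_multiple (separable_poly_neq0 sepq) q0.
pose al := c%:~R * theta.
exists (fun j => al ^+ j); split; first by move=> i; exact: ring_of_integersX.
move=> v v0.
pose x : 'rV[R[i]]_(s + t + t) := \row_i sigma i al.
have Wu : Vandermonde (s + t + t) x \in unitmx.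
  apply: Vandermonde_unit => i j; rewrite !mxE !rmorphM/= !rmorph_int.
  move=> /mulfI; rewrite intr_eq0 => /(_ c0).
  exact: (embeddings_separate sinj).
pose y : 'rV[R[i]]_(s + t + t) := \row_i match fintype.split i with
  | inl k => ccoord v k | inr j => (ccoord v (rshift s j))^* end.
have [l lW] : exists l, l *m Vandermonde (s + t + t) x = y.
  by exists (y *m invmx (Vandermonde (s + t + t) x)); rewrite mulmxKV.
have lE i : \sum_j l 0 j * sigma i al ^+ j = y 0 i.
  by rewrite -lW mxE; apply: eq_bigr => j _; rewrite !mxE.
have yl k : y 0 (lshift t k) = ccoord v k.
  rewrite mxE; case: split_ordP => // j' /eqP; rewrite ?eq_lrshift//.
  by rewrite eq_lshift => /eqP ->.
have yr j : y 0 (rshift (s + t) j) = (ccoord v (rshift s j))^*.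
  rewrite mxE; case: split_ordP => // j' /eqP; rewrite ?eq_rlshift//.
  by rewrite eq_rshift => /eqP ->.
pose l' := map_mx (@conjc R) l.
have l'W i i' : sigma i al = (sigma i' al)^* -> y 0 i = (y 0 i')^* ->
    (l' *m Vandermonde (s + t + t) x) 0 i = y 0 i.
  move=> xi ->; rewrite -lE conjc_sum mxE; apply: eq_bigr => j _.
  by rewrite !mxE xi (rmorphM (@conjc R)) (rmorphXn (@conjc R)).
have ll' : l' = l.
  apply: (can_inj (mulmxK Wu)); rewrite lW; apply/rowP => i.
  case: (split_ordP i) => [k ->|j ->]; last first.
    by apply: (@l'W _ (lshift t (rshift s j))); rewrite ?sconj// yr yl.
  case: (split_ordP k) => [k' ->|j ->].
    apply: (@l'W _ (lshift t (lshift t k'))).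
      have := sreal k' al; rewrite /emb_real.
      by case: (sigma _ al) => a b /= ->; rewrite oppr0.
    by rewrite yl /ccoord v0 /= oppr0.
  apply: (@l'W _ (rshift (s + t) j)); first by rewrite sconj conjcK.
  by rewrite yl yr conjcK.
have lre j : l 0 j = (complex.Re (l 0 j))%:C.
  have := congr1 (fun M : 'rV__ => complex.Im (M 0 j)) ll'.
  rewrite mxE; case: (l 0 j) => a b /= /eqP.
  by rewrite eq_sym -addr_eq0 -mulr2n mulrn_eq0/= => /eqP ->.
have ReM (r : R) z : complex.Re (r%:C * z) = r * complex.Re z.
  by case: z => a b /=; rewrite mul0r subr0.
have ImM (r : R) z : complex.Im (r%:C * z) = r * complex.Im z.
  by case: z => a b /=; rewrite mul0r addr0.
have ReS (F : 'I_(s + t + t) -> R[i]) : complex.Re (\sum_i F i) = \sum_i complex.Re (F i).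
  by apply: (big_morph (@complex.Re R)) => // -[a b] [a' b'].
have ImS (F : 'I_(s + t + t) -> R[i]) : complex.Im (\sum_i F i) = \sum_i complex.Im (F i).
  by apply: (big_morph (@complex.Im R)) => // -[a b] [a' b'].
exists (fun j => complex.Re (l 0 j)).
rewrite [LHS]surjective_pairing [RHS]surjective_pairing fst_sum snd_sum; congr pair.
- apply/rowP => k; have := congr1 (@complex.Re R) (lE (lshift t k)).
  rewrite yl /= => <-; rewrite ReS summxE; apply: eq_bigr => j _.
  by rewrite !mxE {1}lre ReM rmorphXn.
- apply/rowP => k; have := congr1 (@complex.Im R) (lE (lshift t k)).
  rewrite yl /= => <-; rewrite ImS summxE; apply: eq_bigr => j _.
  by rewrite !mxE {1}lre ImM rmorphXn.
Qed.

Definition normsq (z : R[i]) : R := complex.Re z ^+ 2 + complex.Im z ^+ 2.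

(** Pairing each non-real embedding with its conjugate shows that the left side is the norm of [u].
    It is a positive real and an integer unit, hence 1. *)
Lemma positive_unit_norm (u : K) : positive_units sigma u ->
  (\prod_(k < s) complex.Re (emb_real sigma k u)) *
  (\prod_(j < t) normsq (sigma (lshift t (rshift s j)) u)) = 1.
Proof.
have [sinj sall sreal _ sconj] := hsigma.
move=> [uu upos]; have [d dE du] := prod_embeddings_unit sinj sall uu.
have [u0 _ _] := uu.
set A := \prod_(k < s) _; set B := \prod_(j < t) _.
have A0 : 0 < A.
  by apply: prodr_gt0 => k _; have := upos k; rewrite ltcE => /andP[].
have B0 : 0 < B.
  apply: prodr_gt0 => j _; rewrite lt_neqAle addr_ge0 ?sqr_ge0// andbT eq_sym.
  rewrite paddr_eq0 ?sqr_ge0// !sqrf_eq0.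
  have : sigma (lshift t (rshift s j)) u != 0 by rewrite fmorph_eq0.
  by rewrite eq_complex.
have dAB : (A * B)%:C = d%:~R :> R[i].
  rewrite -dE big_split_ord big_split_ord/= rmorphM !rmorph_prod/= -mulrA.
  congr (_ * _).
    apply: eq_bigr => k _; have := sreal k u; rewrite /emb_real.
    by case: (sigma _ u) => a b /= ->.
  rewrite -big_split; apply: eq_bigr => j _; rewrite sconj /normsq/=.
  case: (sigma _ u) => a b /=; simpc.
  by congr (_ +i* _); rewrite ?expr2; ring.
have {}dAB : A * B = d%:~R.
  by move: dAB; rewrite -(rmorph_int (real_complex R)) => /complexI.
have d0 : 0 < d by rewrite -(ltr0z R) -dAB mulr_gt0.
by rewrite dAB; move: du d0; case: d {dE dAB} => // -[|[]].
Qed.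

(** Positivity of [s] enters here: a member of an independent family cannot be 1, as it would
    satisfy a relation by itself. This unit is what forces translations to have period zero. *)
Lemma exists_nontrivial_unit (U : set K) : (0 < s)%N -> OT_subgroup sigma U ->
  exists2 u, U u & u != 1.
Proof.
move=> s0 [_ _ [[e Ue ind] _] _ _]; exists (e (Ordinal s0)) => //.
apply/eqP => e1; have := ind (fun i => (i == Ordinal s0)%:Z).
rewrite big1; first by move=> /(_ erefl (Ordinal s0)); rewrite eqxx.
by move=> i _; case: eqVneq => [->|_]; rewrite ?e1 ?exp1rz ?expr0z.
Qed.

(* An integer polynomial [q] killing [u] gives [0 = chi (q(u) a) = q(1) chi a], and
   [q(1) != 0] once the factors [X - 1] are removed from [q]. *)
Lemma unit_invariant_character_eq0 (u : K) (chi : K -> R) :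
  ring_of_integers u -> u != 1 ->
  (forall a b, ring_of_integers a -> ring_of_integers b -> chi (a + b) = chi a + chi b) ->
  (forall a, ring_of_integers a -> chi (u * a) = chi a) ->
  forall a, ring_of_integers a -> chi a = 0.
Proof.
move=> iu u1 chiD chiu a ia.
have chi0 : chi 0 = 0.
  by apply: (addrI (chi 0)); rewrite -chiD ?addr0//; exact: ring_of_integers0.
have chiN b : ring_of_integers b -> chi (- b) = - chi b.
  move=> ib; apply/eqP; rewrite -addr_eq0 -chiD ?addNr ?chi0//.
  exact: integral_opp.
have iz (c : int) (b : K) : ring_of_integers b -> ring_of_integers (c%:~R * b).
  by move=> ib; apply: ring_of_integersM => //; exact: integral_id.
have chin (n : nat) (b : K) : ring_of_integers b -> chi (n%:R * b) = n%:R * chi b.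
  move=> ib; elim: n => [|n IH]; first by rewrite !mul0r.
  by rewrite -!natr1 !mulrDl !mul1r chiD ?IH//; exact: (iz n).
have chiz (c : int) (b : K) : ring_of_integers b -> chi (c%:~R * b) = c%:~R * chi b.
  move=> ib; case: c => c; first exact: chin.
  by rewrite NegzE !rmorphN !mulNr chiN ?chin//; exact: (iz c.+1).
have chiX n : chi (u ^+ n * a) = chi a.
  elim: n => [|n IH]; first by rewrite mul1r.
  rewrite exprS -mulrA chiu//; apply: ring_of_integersM => //.
  exact: ring_of_integersX.
have chip (p : {poly int}) : ring_of_integers ((map_poly intr p).[u] * a) /\
    chi ((map_poly intr p).[u] * a) = p.[1]%:~R * chi a.
  elim/poly_ind: p => [|p c [ip IH]].
    by rewrite rmorph0 !horner0 !mul0r; split => //; exact: ring_of_integers0.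
  rewrite rmorphD rmorphM/= map_polyX map_polyC !hornerE mulrDl [_ * u]mulrC -mulrA.
  have iup : ring_of_integers (u * ((map_poly intr p).[u] * a)).
    exact: ring_of_integersM.
  split; first by apply: integral_add => //; exact: iz.
  by rewrite chiD//; [rewrite chiu// IH chiz// rmorphD/= mulrDl | exact: iz].
have [p mp rp] := iu.
have [m [q nq pE]] := multiplicity_XsubC p 1.
have rq : (map_poly intr q).[u] = 0.
  move: rp; rewrite pE rmorphM rmorphXn/= rmorphB/= map_polyX map_polyC/=.
  rewrite /root hornerM horner_exp !hornerE mulf_eq0 expf_eq0 subr_eq0.
  by rewrite (negPf u1) andbF orbF => /eqP.
have [_] := chip q; rewrite rq mul0r chi0 => /esym/eqP; rewrite mulf_eq0 intr_eq0.
have -> : (q.[1] == 0) = false.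
  by move: nq; rewrite monic_neq0//= /root => /negPf.
by move=> /eqP.
Qed.

End OTNumberField.

(** * The action on the upper domain *)

Section OTGeometry.
Variables (R : realType) (s t : nat) (K : fieldExtType rat).
Variable sigma : 'I_(s + t + t) -> {rmorphism K -> R[i]}.
Hypothesis hsigma : embeddings_of_type sigma.
Local Notation V := (cspace R (s + t)).
Local Notation D := (@upper_domain R s t).
Local Notation sg k := (sigma (lshift t k)).

Lemma upper_domain_open : open D.
Proof.
rewrite openE => p Dp.
have nearD (k : 'I_s) : \forall q \near (p : V), 0 < (q : V).2 0 (lshift t k).
  have c := @snd_coord_continuous R _ (lshift t k) p.
  by apply: (c [set x | 0 < x]); apply: open_nbhs_nbhs; split;
    [exact: open_gt | exact: Dp].
exact: (filter_forall _ nearD).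
Qed.

Lemma upper_domain_convex (p q : V) (x : R) : D p -> D q -> 0 <= x <= 1 ->
  D (p + x *: (q - p)).
Proof.
move=> Dp Dq /andP[x0 x1] k; have := Dp k; have := Dq k; rewrite /= !mxE => qk pk.
have -> : p.2 0 (lshift t k) + x * (q.2 0 (lshift t k) - p.2 0 (lshift t k)) =
  (1 - x) * p.2 0 (lshift t k) + x * q.2 0 (lshift t k) by ring.
have [->|x_neq0] := eqVneq x 0; first by rewrite subr0 mul1r mul0r addr0.
rewrite ltr_wpDl ?mulr_gt0 ?mulr_ge0 ?subr_ge0 ?(ltW pk)//.
by rewrite lt_neqAle eq_sym x_neq0.
Qed.

Lemma upper_domain_line (e : V) : (forall k : 'I_s, e.2 0 (lshift t k) = 0) ->
  line_invariant D e.
Proof. by move=> e0 p x Dp k; rewrite /= !mxE e0 mulr0 addr0; exact: Dp. Qed.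

Lemma dilate_fst (u : K) (p : V) k : (dilate sigma u p).1 0 k =
  complex.Re (sg k u) * p.1 0 k - complex.Im (sg k u) * p.2 0 k.
Proof. by rewrite /= mxE /ccoord; case: (sg k u). Qed.

Lemma dilate_snd (u : K) (p : V) k : (dilate sigma u p).2 0 k =
  complex.Re (sg k u) * p.2 0 k + complex.Im (sg k u) * p.1 0 k.
Proof. by rewrite /= mxE /ccoord; case: (sg k u). Qed.

Lemma translE (a : K) (p : V) : transl sigma a p = p + embedding_vector sigma a.
Proof.
case: p => x y; congr pair; apply/rowP => k; rewrite !mxE /ccoord /=.
  by case: (sg k a).
by case: (sg k a).
Qed.

Lemma dilate_linear (u : K) : linear (dilate sigma u : V -> V).
Proof.
move=> c p q.
have E1 (x y : V) k : (c *: x + y).1 0 k = c * x.1 0 k + y.1 0 k by rewrite /= !mxE.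
have E2 (x y : V) k : (c *: x + y).2 0 k = c * x.2 0 k + y.2 0 k by rewrite /= !mxE.
rewrite [LHS]surjective_pairing [RHS]surjective_pairing.
congr pair; apply/rowP => k.
  by rewrite dilate_fst !E1 E2 !dilate_fst; ring.
by rewrite dilate_snd E1 !E2 !dilate_snd; ring.
Qed.

Lemma dilateM (u v : K) (p : V) :
  dilate sigma u (dilate sigma v p) = dilate sigma (u * v) p.
Proof.
rewrite [LHS]surjective_pairing [RHS]surjective_pairing.
congr pair; apply/rowP => k.
  rewrite !dilate_fst dilate_snd rmorphM.
  case: (sg k u) => a b; case: (sg k v) => c d /=; ring.
rewrite !dilate_snd dilate_fst rmorphM.
case: (sg k u) => a b; case: (sg k v) => c d /=; ring.
Qed.

Lemma dilate_id (p : V) : dilate sigma 1 p = p.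
Proof.
rewrite [LHS]surjective_pairing [RHS]surjective_pairing.
congr pair; apply/rowP => k.
  by rewrite dilate_fst rmorph1/= mul1r mul0r subr0.
by rewrite dilate_snd rmorph1/= mul1r mul0r addr0.
Qed.

Lemma dilate_embedding_vector (u a : K) :
  dilate sigma u (embedding_vector sigma a) = embedding_vector sigma (u * a).
Proof.
rewrite [LHS]surjective_pairing [RHS]surjective_pairing.
congr pair; apply/rowP => k; rewrite ?dilate_fst ?dilate_snd !mxE rmorphM;
  case: (sg k u) => b c; case: (sg k a) => b' c' //=; ring.
Qed.

Lemma embedding_vector0 : embedding_vector sigma 0 = 0.
Proof. by congr pair; apply/rowP => k; rewrite !mxE rmorph0. Qed.

Lemma embedding_vectorD (a b : K) : embedding_vector sigma (a + b) =
  embedding_vector sigma a + embedding_vector sigma b.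
Proof.
by congr pair; apply/rowP => k; rewrite !mxE rmorphD;
  case: (sg k a) => ? ?; case: (sg k b).
Qed.

Lemma dilate_upper (u : K) (p : V) (k : 'I_s) : (dilate sigma u p).2 0 (lshift t k) =
  complex.Re (emb_real sigma k u) * p.2 0 (lshift t k).
Proof.
have [_ _ sreal _ _] := hsigma.
by rewrite dilate_snd -/(emb_real sigma k) sreal mul0r addr0.
Qed.

Lemma embedding_vector_upper (a : K) (k : 'I_s) :
  (embedding_vector sigma a).2 0 (lshift t k) = 0.
Proof. by have [_ _ sreal _ _] := hsigma; rewrite mxE -/(emb_real sigma k) sreal. Qed.

Lemma dilate_continuous (u : K) : continuous (dilate sigma u : V -> V).
Proof.
pose S (r : seq ('I_(s + t) + 'I_(s + t))) (p : V) : V :=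
  \sum_(i <- r) cspace_coord i p *: dilate sigma u (@cspace_basis R _ i).
have cS r : continuous (S r).
  move=> p; elim: r => [|i r IH].
    rewrite (_ : S [::] = fun=> 0); first exact: cst_continuous.
    by apply/funext => q; rewrite /S big_nil.
  rewrite (_ : S (i :: r) = fun q =>
      cspace_coord i q *: dilate sigma u (cspace_basis R i) + S r q).
    by apply: cvgD IH; apply: cvgZr_tmp; exact: cspace_coord_continuous.
  by apply/funext => q; rewrite /S big_cons.
rewrite (_ : dilate sigma u = S (index_enum _)); first exact: cS.
apply/funext => p; rewrite {1}[p]cspace_coordE.
have L0 : dilate sigma u (0 : V) = 0.
  by have := dilate_linear u (-1) 0 0; rewrite scaler0 addr0 scaleN1r addNr.
have LD (x y : V) : dilate sigma u (x + y) = dilate sigma u x + dilate sigma u y.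
  by have := dilate_linear u 1 x y; rewrite !scale1r.
rewrite (big_morph _ LD L0); apply: eq_bigr => i _.
by have := dilate_linear u (cspace_coord i p) (cspace_basis R i) 0; rewrite L0 !addr0.
Qed.

(** Pullbacks are defined with the total differential, so the affine map is first shown
    differentiable, through continuity of its linear part; the differential is then read off along
    lines. *)
Lemma diff_transl_dilate (u a : K) (p v : V) :
  'd (transl sigma a \o dilate sigma u : V -> V) p v = dilate sigma u v.
Proof.
pose L : {linear V -> V} := HB.pack (dilate sigma u : V -> V)
  (GRing.isLinear.Build R V V *:%R (dilate sigma u) (dilate_linear u)).
have -> : (transl sigma a \o dilate sigma u : V -> V) =
    (L : V -> V) + cst (embedding_vector sigma a).
  by apply/funext => q; rewrite /= translE.
have dL : differentiable L p by apply: linear_differentiable; exact: dilate_continuous.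
have dc : differentiable (cst (embedding_vector sigma a) : V -> V) p.
  exact: differentiable_cst.
have dg : differentiable ((L : V -> V) + cst (embedding_vector sigma a)) p.
  exact: (differentiableD dL dc).
rewrite -(deriveE v dg).
suff [_ ->] : is_derive p v ((L : V -> V) + cst (embedding_vector sigma a))
  (dilate sigma u v) by [].
apply/is_derive_line0P.
pose c : V := dilate sigma u p + embedding_vector sigma a.
rewrite (_ : (fun h : R => _) = (fun h : R => id (c + h *: dilate sigma u v))).
  by apply/(@is_derive_line0P _ _ _ (id : V -> V)); exact: is_derive_id.
apply/funext => h; transitivity (dilate sigma u (p + h *: v) + embedding_vector sigma a).
  by [].
have -> : dilate sigma u (p + h *: v) =
    dilate sigma u p + h *: dilate sigma u v.
  by rewrite addrC dilate_linear addrC.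
by rewrite /c/= addrAC.
Qed.

End OTGeometry.

(** * Invariance and closedness of theta *)

Section OTTheta.
Variables (R : realType) (s t : nat) (K : fieldExtType rat).
Variable sigma : 'I_(s + t + t) -> {rmorphism K -> R[i]}.
Variable U : set K.
Hypothesis hsigma : embeddings_of_type sigma.
Hypothesis hU : OT_subgroup sigma U.
Local Notation V := (cspace R (s + t)).
Local Notation D := (@upper_domain R s t).
Definition volume (q : V) : R := \prod_(k < s) q.2 0 (lshift t k).

Lemma volume_gt0 (p : V) : D p -> 0 < volume p.
Proof. by move=> Dp; apply: prodr_gt0 => k _; exact: Dp. Qed.

Lemma volume_continuous : continuous volume.
Proof.
pose S (r : seq 'I_s) (q : V) : R := \prod_(k <- r) q.2 0 (lshift t k).
suff cS r : continuous (S r) by exact: (cS (index_enum _)).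
move=> p; elim: r => [|k r IH].
  rewrite (_ : S [::] = fun=> 1); first exact: cst_continuous.
  by apply/funext => q; rewrite /S big_nil.
rewrite (_ : S (k :: r) = fun q => q.2 0 (lshift t k) * S r q).
  by apply: cvgM IH; exact: snd_coord_continuous.
by apply/funext => q; rewrite /S big_cons.
Qed.

Lemma is_derive_ln_volume (p v : V) : D p ->
  is_derive p v (fun q => ln (volume q))
    (\sum_(k < s) v.2 0 (lshift t k) * (p.2 0 (lshift t k))^-1).
Proof.
move=> Dp.
apply: (@eq_on_is_derive R _ D (fun q : V => \sum_(k < s) ln (q.2 0 (lshift t k)))) => //.
- exact: upper_domain_open.
-  move=> q Dq; have : forall r : seq 'I_s, 0 < \prod_(k <- r) q.2 0 (lshift t k) /\
      \sum_(k <- r) ln (q.2 0 (lshift t k)) = ln (\prod_(k <- r) q.2 0 (lshift t k)).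
    elim=> [|k r [r0 IH]]; first by rewrite !big_nil ln1 ltr01.
    by rewrite !big_cons mulr_gt0 ?(Dq k)// IH lnM ?posrE ?(Dq k).
  by case/(_ (index_enum _)).
apply: is_derive_sumr => k; rewrite mulrC.
apply: is_derive_comp1; last exact: is_derive1_ln (Dp k).
have lk : scalar (fun q : V => q.2 0 (lshift t k)) by move=> c x y; rewrite /= !mxE.
exact: is_derive_scalar lk.
Qed.

Lemma OT_thetaE (p v : V) : D p -> OT_theta R s t p v =
  t%:R^-1 * \sum_(k < s) v.2 0 (lshift t k) * (p.2 0 (lshift t k))^-1.
Proof.
by move=> Dp; rewrite /OT_theta /ext_d0; have [_ ->] := is_derive_ln_volume v Dp.
Qed.

(** In coordinates theta is (1/t) times the sum of the dv_k / v_k. Translations fix [v_k], and a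
    unit multiplies [v_k] and dv_k by the same positive number, so each term is invariant; the
    derivative of each term is symmetric in the two tangent vectors, so it is closed. *)
Lemma OT_theta_X_closed : X_closed1 sigma U (OT_theta R s t).
Proof.
have oD := @upper_domain_open R s t.
have Ck n k : is_Ck n D (fun p : V => (p.2 0 (lshift t k))^-1).
  apply: is_CkV => //; last exact: is_Ck_snd_coord.
  by move=> p Dp; rewrite gt_eqF//; exact: Dp.
have [_ Upos _ _ _] := hU.
split; first split; first split.
- move=> p Dp c u v; rewrite !OT_thetaE// mulrCA -mulrDr; congr (_ * _).
  rewrite mulr_sumr -big_split; apply: eq_bigr => k _ /=.
  by rewrite !mxE mulrDl mulrA.
- move=> v n; apply: (eq_on_is_Ck oD (f := fun p =>
    t%:R^-1 * \sum_(k < s) v.2 0 (lshift t k) * (p.2 0 (lshift t k))^-1)).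
    by move=> p Dp; rewrite OT_thetaE.
  apply: is_CkZ => //; apply: is_Ck_sum => // k; exact: is_CkZ.
- move=> _ [u [a [Uu ia ->]]] p Dp v; rewrite /pullback1 diff_transl_dilate.
  have upos (k : 'I_s) : 0 < complex.Re (emb_real sigma k u).
    by have [_ /(_ k)] := Upos _ Uu; rewrite ltcE => /andP[].
  have E k : (transl sigma a (dilate sigma u p)).2 0 (lshift t k) =
      complex.Re (emb_real sigma k u) * p.2 0 (lshift t k).
    rewrite translE -(dilate_upper hsigma) [LHS]/= mxE.
    by rewrite (embedding_vector_upper hsigma) addr0.
  have Dg : D (transl sigma a (dilate sigma u p)).
    by move=> k; rewrite E mulr_gt0//; exact: Dp.
  rewrite !OT_thetaE//; congr (_ * _); apply: eq_bigr => k _.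
  rewrite [X in _ * X^-1]E (dilate_upper hsigma) invfM mulrACA divff ?mul1r//.
  by rewrite gt_eqF.
move=> p Dp u v; apply/eqP; rewrite /ext_d1 subr_eq0; apply/eqP.
have dtheta (x y : V) : 'D_x (fun q => OT_theta R s t q y) p =
    t%:R^-1 * \sum_(k < s) y.2 0 (lshift t k) *
      (- (p.2 0 (lshift t k)) ^- 2 * x.2 0 (lshift t k)).
  suff [_ ->] : is_derive p x (fun q => OT_theta R s t q y) (t%:R^-1 * \sum_(k < s)
    y.2 0 (lshift t k) * (- (p.2 0 (lshift t k)) ^- 2 * x.2 0 (lshift t k))) by [].
  apply: (eq_on_is_derive oD Dp (f := fun p =>
    t%:R^-1 * \sum_(k < s) y.2 0 (lshift t k) * (p.2 0 (lshift t k))^-1)).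
    by move=> q Dq; rewrite OT_thetaE.
  apply: is_deriveZ; apply: is_derive_sumr => k; apply: is_deriveZ.
  have lk : scalar (fun q : V => q.2 0 (lshift t k)) by move=> c z z'; rewrite /= !mxE.
  have [dk <-] := is_derive_scalar p x lk.
  have pk : p.2 0 (lshift t k) != 0 by rewrite gt_eqF//; exact: Dp.
  by apply: DeriveDef; [exact: derivableV | exact: deriveV].
refine (etrans (dtheta u v) (etrans _ (esym (dtheta v u)))).
congr (_ * _); apply: eq_bigr => k _.
by rewrite mulrCA [RHS]mulrCA [X in _ * X]mulrC.
Qed.

End OTTheta.

(** * The Lee form of an LCK metric *)

Section LCKLeeForm.
Variables (R : realType) (s t : nat) (K : fieldExtType rat).
Variable sigma : 'I_(s + t + t) -> {rmorphism K -> R[i]}.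
Variable U : set K.
Hypothesis s_gt0 : (0 < s)%N.
Hypothesis hsigma : embeddings_of_type sigma.
Hypothesis hU : OT_subgroup sigma U.
Local Notation V := (cspace R (s + t)).
Local Notation D := (@upper_domain R s t).
Variables (h : form2 R (s + t)) (eta : form1 R (s + t)).
Hypothesis lck : is_LCK sigma U h eta.
Variable F : V -> R.
Hypothesis sF : smooth_on D F.
Hypothesis dF : forall p, D p -> forall v, is_derive p v F (eta p v).

Let oD : open D := @upper_domain_open R s t.

(** All coordinates equal to i. It serves as the centre of the star in the Poincare lemma and as the
    point where periods are read off. *)
Definition base_point : V := (0, const_mx 1).

Lemma base_pointP : D base_point.
Proof. by move=> k; rewrite /= mxE ltr01. Qed.

Lemma unit_re_gt0 u (k : 'I_s) : U u -> 0 < complex.Re (emb_real sigma k u).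
Proof.
by have [_ Upos _ _ _] := hU; move=> /Upos[_ /(_ k)]; rewrite ltcE => /andP[].
Qed.

Lemma dilate_domain u p : U u -> D p -> D (dilate sigma u p).
Proof.
by move=> Uu Dp k; rewrite (dilate_upper hsigma) mulr_gt0 ?unit_re_gt0//; exact: Dp.
Qed.

Lemma transl_domain a p : D p -> D (p + embedding_vector sigma a).
Proof.
move=> Dp; rewrite -[embedding_vector _ _]scale1r; apply: upper_domain_line => //.
exact: embedding_vector_upper.
Qed.

Let gamma u a p := dilate sigma u p + embedding_vector sigma a.

Let gamma_dilate u p : gamma u 0 p = dilate sigma u p.
Proof. by rewrite /gamma embedding_vector0 addr0. Qed.

Let gamma_transl a p : gamma 1 a p = p + embedding_vector sigma a.
Proof. by rewrite /gamma dilate_id. Qed.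

Let Gamma_pair u a : U u -> ring_of_integers a ->
  Gamma sigma U (transl sigma a \o dilate sigma u).
Proof. by move=> Uu ia; exists u, a. Qed.

Lemma eta_equivariant u a p v : U u -> ring_of_integers a -> D p ->
  eta (gamma u a p) (dilate sigma u v) = eta p v.
Proof.
move=> Uu ia Dp; have [_ [[_ inv] _] _] := lck.
have := inv _ (Gamma_pair Uu ia) p Dp v.
by rewrite /pullback1 diff_transl_dilate /= translE.
Qed.

Lemma metric_equivariant u a p v v' : U u -> ring_of_integers a -> D p ->
  h (gamma u a p) (dilate sigma u v) (dilate sigma u v') = h p v v'.
Proof.
move=> Uu ia Dp; have [[_ inv] _ _] := lck.
have := inv _ (Gamma_pair Uu ia) p Dp v v'.
by rewrite /pullback2 !diff_transl_dilate /= translE.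
Qed.

Definition period u a : R := F (gamma u a base_point) - F base_point.

Lemma primitive_equivariant u a p : U u -> ring_of_integers a -> D p ->
  F (gamma u a p) = F p + period u a.
Proof.
move=> Uu ia Dp.
pose G q := F (gamma u a q) - F q.
suff : G p = G base_point by rewrite /G /period => /eqP; rewrite subr_eq addrC => /eqP.
rewrite -[p](subrK base_point) addrC; apply: constant_on_segment => x x01.
have Dx : D (base_point + x *: (p - base_point)).
  by apply: upper_domain_convex => //; exact: base_pointP.
set q := base_point + _; set v := p - _.
have dg : is_derive q v (fun q => F (gamma u a q)) (eta q v).
  apply/is_derive_line0P.
  rewrite (_ : (fun r : R => _) = (fun r => F (gamma u a q + r *: dilate sigma u v))).
    apply/(@is_derive_line0P _ _ _ F); rewrite -(eta_equivariant _ Uu ia Dx).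
    by apply: dF; apply: transl_domain; exact: dilate_domain.
  apply/funext => r; congr F; rewrite /gamma [q + _]addrC dilate_linear.
  by rewrite [r *: _ + _]addrC addrAC.
by rewrite -(subrr (eta q v)); apply: is_deriveB; exact: dF.
Qed.

(** Moving the dilation by [u] past the translation by [b] turns the latter into the translation by
    [u * b]. Computing [F] at the image point in both ways gives [period 1 (u * b) = period 1 b], so
    [period 1] is an additive character invariant under multiplication by [u]. *)
Lemma period_translation a : ring_of_integers a -> period 1 a = 0.
Proof.
have [[U1 UM UV] Upos _ _ _] := hU.
have i0 := ring_of_integers0 K.
have [u Uu u1] := exists_nontrivial_unit s_gt0 hU.
apply: (@unit_invariant_character_eq0 R K u (period 1)).
- by have [[_ ]] := Upos _ Uu.
- exact: u1.
- move=> b c ib ic; rewrite {1}/period gamma_transl embedding_vectorD addrA -!gamma_transl.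
  rewrite primitive_equivariant// ?gamma_transl; last first.
    by apply: transl_domain; exact: base_pointP.
  by rewrite -gamma_transl primitive_equivariant//; [ring | exact: base_pointP].
- move=> b ib; have Db : D (base_point + embedding_vector sigma b).
    by apply: transl_domain; exact: base_pointP.
  have iub : ring_of_integers (u * b).
    by apply: ring_of_integersM => //; have [[_ ]] := Upos _ Uu.
  have := primitive_equivariant Uu i0 Db.
  rewrite -gamma_transl (primitive_equivariant U1 ib base_pointP) gamma_dilate gamma_transl.
  have -> : dilate sigma u (base_point + embedding_vector sigma b) =
      gamma 1 (u * b) (dilate sigma u base_point).
    rewrite gamma_transl -dilate_embedding_vector -[base_point]scale1r dilate_linear.
    by rewrite !scale1r.
  rewrite primitive_equivariant//; last by apply: dilate_domain => //; exact: base_pointP.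
  rewrite -gamma_dilate (primitive_equivariant Uu i0 base_pointP) addrAC.
  by move=> /addIr /addrI.
Qed.

Let wform : form2 R (s + t) := fun p u v => expR (- F p) * fundamental_form h p u v.

Let Ck_expF n : is_Ck n D (fun p => expR (- F p)).
Proof.
apply: is_Ck_expR => //; apply: (eq_on_is_Ck oD (f := fun p => -1 * F p)).
  by move=> p _; rewrite mulN1r.
by apply: is_CkZ => //; exact: sF.
Qed.

Lemma is_Ck_wform u v : is_Ck 1 D (fun p => wform p u v).
Proof.
have [[[sh _ _ _ _] _] _ _] := lck.
by apply: is_CkM; [exact: oD | exact: Ck_expF | exact: sh].
Qed.

Lemma wform_closed p : D p -> forall x y z, ext_d2 wform p x y z = 0.
Proof.
move=> Dp x y z; have [[[sh _ _ _ _] _] _ dh] := lck.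
have dw a b c : 'D_a (fun q => wform q b c) p = expR (- F p) *
    ('D_a (fun q => fundamental_form h q b c) p - eta p a * fundamental_form h p b c).
  have dexp : is_derive p a (fun q => expR (- F q)) (expR (- F p) * - eta p a).
    apply: (is_derive_comp1 (f := fun q => - F q) (g := expR)).
    by apply: is_deriveN; exact: dF.
  have dfund : is_derive p a (fun q => fundamental_form h q b c)
      ('D_a (fun q => fundamental_form h q b c) p).
    exact: (is_CkS_derive a (sh (Jmul b) c 1%N) Dp).
  have [_ ->] := is_deriveM dexp dfund.
  by rewrite /GRing.scale/=; ring.
rewrite /ext_d2 !dw; have := dh p Dp x y z; rewrite /ext_d2 /wedge12 => E.
transitivity (expR (- F p) * ('D_x (fun q => fundamental_form h q y z) p -
  'D_y (fun q => fundamental_form h q x z) p + 'D_z (fun q => fundamental_form h q x y) p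
  - (eta p x * fundamental_form h p y z - eta p y * fundamental_form h p x z +
     eta p z * fundamental_form h p x y))); first by ring.
by rewrite E subrr mulr0.
Qed.

Lemma wform_periodic a p u v : ring_of_integers a -> D p ->
  wform (p + embedding_vector sigma a) u v = wform p u v.
Proof.
move=> ia Dp; have [[U1 _ _] _ _ _ _] := hU.
rewrite /wform /fundamental_form -gamma_transl primitive_equivariant//.
rewrite period_translation// addr0.
congr (_ * _); rewrite -{1}[Jmul u](dilate_id sigma) -{1}[v](dilate_id sigma).
exact: metric_equivariant.
Qed.

(** * The scaling factor in the plane of one coordinate [z_j] *)

Section ComplexDirection.
Variable j : 'I_t.
Let k : 'I_(s + t) := rshift s j.
Let va : V := (delta_mx 0 k, 0).
Let vb : V := (0, delta_mx 0 k).

Let J_va : Jmul va = vb.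
Proof. by rewrite /Jmul /= oppr0. Qed.

Let J_vb : Jmul vb = - va.
Proof. by rewrite /Jmul /=; congr pair; rewrite oppr0. Qed.

(** As [vb = Jmul va], the fundamental form on [va], [vb] is the squared length of [vb]. *)
Lemma wform_direction_gt0 p : D p -> 0 < wform p va vb.
Proof.
move=> Dp; have [[[_ _ _ _ pos] _] _ _] := lck.
rewrite /wform mulr_gt0 ?expR_gt0// /fundamental_form J_va; apply: pos => //.
apply/eqP => -[] /(congr1 (fun M : 'rV_ _ => M 0 k)) /eqP.
by rewrite !mxE !eqxx oner_eq0.
Qed.

Lemma normsq_dilate u p : U u -> D p ->
  normsq (sigma (lshift t k) u) * wform (dilate sigma u p) va vb =
  expR (- period u 0) * wform p va vb.
Proof.
move=> Uu Dp; have [[[_ lin sym J pos] _] _ _] := lck.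
have i0 := ring_of_integers0 K.
have Dq : D (dilate sigma u p) by exact: dilate_domain.
rewrite /wform /fundamental_form J_va -{1}gamma_dilate primitive_equivariant// opprD expRD.
have := metric_equivariant vb vb Uu i0 Dp; rewrite gamma_dilate => <-.
set q := dilate sigma u p.
pose x := complex.Re (sigma (lshift t k) u); pose y := complex.Im (sigma (lshift t k) u).
(* On this plane the dilation is multiplication by x + iy, and [vb] is the vector i. *)
have -> : dilate sigma u vb = (- y) *: va + x *: vb.
  rewrite [LHS]surjective_pairing [RHS]surjective_pairing; congr pair; apply/rowP => i.
    rewrite dilate_fst /= !mxE; have [->|_] := eqVneq i k; rewrite /x /y ?eqxx/=; ring.
  rewrite dilate_snd /= !mxE; have [->|_] := eqVneq i k; rewrite /x /y ?eqxx/=; ring.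
have linD w c v v' : h q w (c *: v + v') = c * h q w v + h q w v'.
  exact: lin.
have linZ w c v : h q w (c *: v) = c * h q w v.
  have h0 : h q w 0 = 0.
    by have := linD w (-1) 0 0; rewrite scaler0 addr0 mulN1r addNr.
  by have := linD w c v 0; rewrite !addr0 h0 addr0.
(* Invariance under [Jmul] and symmetry give h(va, vb) = h(vb, -va) = -h(va, vb). With equal lengths
   of [va] and [vb], the image of [vb] has squared length x^2 + y^2 times that of [vb]. *)
have hab : h q va vb = 0.
  have := J _ Dq va vb; rewrite J_va J_vb -scaleN1r linZ [h q vb va]sym// mulN1r.
  by move=> /eqP; rewrite eq_sym -addr_eq0 -mulr2n mulrn_eq0/= => /eqP.
have haa : h q va va = h q vb vb.
  by have := J _ Dq va va; rewrite J_va => <-.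
rewrite linD linZ ![h q (_ + _) _]sym// !linD !linZ haa hab [h q vb va]sym// hab.
rewrite /normsq -/x -/y; ring.
Qed.

(** Here [q] is the quotient of the two sides. The real span of the lattice vectors is exactly R^s x
    C^t, which dilation by [u^-1] preserves; this yields the preimages of span vectors under the
    linear part. *)
Lemma expR_period_le u : U u ->
  expR (- period u 0) <= normsq (sigma (lshift t k) u).
Proof.
move=> Uu; have [[U1 UM UV] Upos _ _ _] := hU.
have [e [ie span]] := integers_real_span hsigma.
have n0 : 0 < normsq (sigma (lshift t k) u).
  have := normsq_dilate Uu base_pointP.
  have w1 := wform_direction_gt0 base_pointP.
  have w2 := wform_direction_gt0 (dilate_domain Uu base_pointP).
  move=> E; rewrite -(pmulr_lgt0 _ w2) E mulr_gt0 ?expR_gt0//.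
suff : expR (- period u 0) / normsq (sigma (lshift t k) u) <= 1.
  by rewrite ler_pdivrMr// mul1r.
have De i : line_invariant D (embedding_vector sigma (e i)).
  by apply: upper_domain_line => l; exact: embedding_vector_upper.
have span_upper v : real_span (fun i => embedding_vector sigma (e i)) v ->
    forall l : 'I_s, v.2 0 (lshift t l) = 0.
  move=> [x ->] l; rewrite snd_sum summxE big1// => i _.
  by rewrite [LHS]/= mxE (embedding_vector_upper hsigma) mulr0.
have lr (l : 'I_s) : (lshift t l == k :> 'I_(s + t)) = false by rewrite eq_lrshift.
have sa : real_span (fun i => embedding_vector sigma (e i)) va.
  by apply: span => l; rewrite mxE.
have sb : real_span (fun i => embedding_vector sigma (e i)) vb.
  by apply: span => l; rewrite mxE eqxx/= lr.
apply: (periodic_scaling_le1 oD De is_Ck_wform wform_closed _ _ sa sb base_pointP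
  wform_direction_gt0 (T := dilate sigma u) (L := dilate sigma u)).
- by move=> i p v v' Dp; exact: wform_periodic.
- exact: upper_domain_convex.
- by move=> p; exact: dilate_domain.
- move=> p v; have := dilate_linear sigma u 1 p v.
  by rewrite !scale1r.
- move=> v sv; exists (dilate sigma u^-1 v).
    apply: span => l; rewrite (dilate_upper hsigma) (span_upper _ sv).
    by rewrite mulr0.
  have [[u0 _ _] _] := Upos _ Uu.
  by rewrite dilateM divff// dilate_id.
- move=> p Dp; apply: (mulfI (lt0r_neq0 n0)).
  transitivity (expR (- period u 0) * wform p va vb); first exact: normsq_dilate.
  by rewrite [_ / _ * _]mulrAC [RHS]mulrC divfK// lt0r_neq0.
Qed.

Lemma normsqM (x y : R[i]) : normsq (x * y) = normsq x * normsq y.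
Proof. by case: x => a b; case: y => c d; rewrite /normsq /=; ring. Qed.

(** The reverse inequality is the previous one for [u^-1]: the period changes sign and the squared
    modulus is inverted. *)
Lemma expR_period u : U u -> expR (- period u 0) = normsq (sigma (lshift t k) u).
Proof.
move=> Uu; have [[U1 UM UV] Upos _ _ _] := hU.
apply/le_anti; rewrite expR_period_le//=.
have [[u0 _ _] _] := Upos _ Uu.
have i0 := ring_of_integers0 K.
have pV : period u^-1 0 = - period u 0.
  have := primitive_equivariant (UV _ Uu) i0 (dilate_domain Uu base_pointP).
  rewrite gamma_dilate dilateM mulVf// dilate_id -[dilate sigma u _]gamma_dilate.
  rewrite (primitive_equivariant Uu i0 base_pointP) -addrA -[LHS]addr0.
  move=> /addrI /esym /eqP.
  by rewrite addr_eq0 => /eqP ->; rewrite opprK.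
have := expR_period_le (UV _ Uu); rewrite pV opprK => le1.
have nV : normsq (sigma (lshift t k) u) * normsq (sigma (lshift t k) u^-1) = 1.
  by rewrite -normsqM -rmorphM divff// rmorph1 /normsq/= expr1n expr0n addr0.
have n0 : 0 <= normsq (sigma (lshift t k) u) by rewrite addr_ge0 ?sqr_ge0.
have := ler_wpM2l n0 le1; rewrite nV => le2.
by rewrite expRN -[leRHS]mul1r ler_pdivlMr ?expR_gt0.
Qed.

End ComplexDirection.

Lemma period_unit u : U u ->
  period u 0 *+ t = ln (\prod_(l < s) complex.Re (emb_real sigma l u)).
Proof.
move=> Uu; have [_ Upos _ _ _] := hU.
have := positive_unit_norm hsigma (Upos _ Uu).
set A := \prod_(l < s) _.
have A0 : 0 < A by apply: prodr_gt0 => l _; exact: unit_re_gt0.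
under eq_bigr => j _ do rewrite -(expR_period j Uu).
rewrite prodr_const card_ord -expRM_natr => E.
have : ln (A * expR (- period u 0 * t%:R)) = 0 by rewrite E ln1.
by rewrite lnM ?posrE ?expR_gt0// expRK mulNr mulr_natr => /eqP; rewrite subr_eq0 => /eqP.
Qed.

Hypothesis t_gt0 : (0 < t)%N.

Lemma Lee_form_cohomologous : exists2 f, X_function sigma U f &
  forall p, D p -> forall v, eta p v - OT_theta R s t p v = ext_d0 f p v.
Proof.
have [_ [[[_ seta] _] _] _] := lck.
have [[[_ stheta] _] _] := OT_theta_X_closed hsigma hU.
have [[U1 UM UV] Upos _ _ _] := hU.
have i0 := ring_of_integers0 K.
have t0 : t%:R != 0 :> R by rewrite pnatr_eq0 -lt0n.
pose f (p : V) := F p - t%:R^-1 * ln (volume p).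
have df p v : D p -> is_derive p v f (eta p v - OT_theta R s t p v).
  move=> Dp; apply: is_deriveB; first exact: dF.
  rewrite OT_thetaE//; apply: is_deriveZ; exact: is_derive_ln_volume.
exists f; last by move=> p Dp v; rewrite /ext_d0; have [_ ->] := df p v Dp.
split.
  have cf p : D p -> {for p, continuous f}.
    move=> Dp; apply: cvgB; first exact: (is_Ck_continuous (sF 0%N) Dp).
    have [/derivable1_diffP dln _] := is_derive1_ln (volume_gt0 Dp).
    apply: cvgMr; apply: (@continuous_comp _ _ _ (@volume R s t) (@ln R)).
      exact: volume_continuous.
    exact: differentiable_continuous.
  case=> [|n]; first by split.
  apply: (@is_CkS _ _ _ _ _ (fun v p => eta p v - OT_theta R s t p v)) => [||v].
  - exact: oD.
  - exact: cf.
  - by apply: is_CkB => //; [exact: seta | exact: stheta].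
move=> _ [u [a [Uu ia ->]]] p Dp.
have Du := dilate_domain Uu Dp.
(* The group element is read as a dilation followed by a pure translation. The translation changes
   neither [F] nor [volume], so only the period of [u] has to match the logarithm of the factor by
   which [u] scales [volume]. *)
have gE : (transl sigma a \o dilate sigma u) p = gamma 1 a (dilate sigma u p).
  by rewrite gamma_transl /= translE.
have FE : F (gamma 1 a (dilate sigma u p)) = F p + period u 0.
  rewrite primitive_equivariant// period_translation// addr0.
  by rewrite -(primitive_equivariant Uu i0 Dp) gamma_dilate.
have volE : volume (gamma 1 a (dilate sigma u p)) =
    \prod_(l < s) complex.Re (emb_real sigma l u) * volume p.
  rewrite /volume -big_split; apply: eq_bigr => l _.
  apply: etrans (dilate_upper hsigma u p l); rewrite /gamma dilate_id [LHS]/= mxE.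
  by rewrite (embedding_vector_upper hsigma) addr0.
have A0 : 0 < \prod_(l < s) complex.Re (emb_real sigma l u).
  by apply: prodr_gt0 => l _; exact: unit_re_gt0.
rewrite gE /f FE volE lnM ?posrE ?volume_gt0// -period_unit//.
by rewrite -[period _ _ *+ t]mulr_natl mulrDr mulKf// opprD addrA addrK.
Qed.

End LCKLeeForm.

Lemma X_functionN (R : realType) (s t : nat) (K : fieldExtType rat)
    (sigma : 'I_(s + t + t) -> {rmorphism K -> R[i]}) (U : set K)
    (f : cspace R (s + t) -> R) :
  X_function sigma U f -> X_function sigma U (fun p => - f p).
Proof.
have oD := @upper_domain_open R s t; move=> [sf invf]; split.
  move=> n; apply: (eq_on_is_Ck oD (f := fun p => -1 * f p)).
    by move=> p _; rewrite mulN1r.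
  exact: is_CkZ.
by move=> g Gg p Dp; rewrite invf.
Qed.

Lemma X_functionD (R : realType) (s t : nat) (K : fieldExtType rat)
    (sigma : 'I_(s + t + t) -> {rmorphism K -> R[i]}) (U : set K)
    (f g : cspace R (s + t) -> R) :
  X_function sigma U f -> X_function sigma U g ->
  X_function sigma U (fun p => f p + g p).
Proof.
have oD := @upper_domain_open R s t; move=> [sf invf] [sg invg]; split.
  by move=> n; exact: is_CkD.
by move=> k Gk p Dp; rewrite invf// invg.
Qed.

(** A class is the set of its representatives, so equality of classes amounts to two inclusions. The
    second comes from this lemma applied to the opposite function, which still descends to the
    quotient. *)
Lemma sub_deRham_class (R : realType) (s t : nat) (K : fieldExtType rat)
    (sigma : 'I_(s + t + t) -> {rmorphism K -> R[i]}) (U : set K)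
    (a b : form1 R (s + t)) (f : cspace R (s + t) -> R) :
  X_function sigma U f ->
  (forall p, @upper_domain R s t p -> forall v, a p v - b p v = ext_d0 f p v) ->
  deRham_class sigma U a `<=` deRham_class sigma U b.
Proof.
move=> Xf ab c [Xc [g Xg ca]]; split=> //.
exists (fun p => g p + f p); first exact: X_functionD.
move=> p Dp v; rewrite -(subrK (a p v) (c p v)) -addrA ca// ab// /ext_d0.
have [[sf _] [sg _]] := (Xf, Xg).
have [_ ->] := is_deriveD (is_CkS_derive v (sg 1%N) Dp) (is_CkS_derive v (sf 1%N) Dp).
by [].
Qed.

Theorem proposition6p5 (R : realType) (s t : nat) (K : fieldExtType rat)
    (sigma : 'I_(s + t + t) -> {rmorphism K -> R[i]}) (U : set K)
    (s_gt0 : (0 < s)%N) (t_gt0 : (0 < t)%N)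
    (hsigma : embeddings_of_type sigma) (hU : OT_subgroup sigma U) :
  X_closed1 sigma U (OT_theta R s t) /\
  Lee_classes sigma U `<=` [set deRham_class sigma U (OT_theta R s t)].
Proof.
split; first exact: OT_theta_X_closed.
move=> _ [h [eta [lck ->]]] /=.
have [_ [[seta _] deta] _] := lck.
have [|F sF dF] := @closed_form1_exact R _ (@upper_domain R s t) (base_point R s t)
  (@upper_domain_open R s t) _ eta seta deta.
  by move=> p x Dp /in01P x01; apply: upper_domain_convex => //; exact: base_pointP.
have [f Xf fE] := Lee_form_cohomologous s_gt0 hsigma hU lck sF dF t_gt0.
apply/seteqP; split; first exact: (sub_deRham_class Xf fE).
apply: (sub_deRham_class (X_functionN Xf)) => p Dp v.
rewrite -opprB fE// /ext_d0; have [sf _] := Xf.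
by have [_ ->] := is_deriveN (is_CkS_derive v (sf 1%N) Dp).
Qed.
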